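(* Let $d\ge 3$ be a fixed odd integer. Then, for all sufficiently large $n$, $$\rho(n,d)=d-\frac{(d-1)\pi^2}{4\left(n+\frac{d-1}{2}\right)^2}+O_d(n^{-4})=d-\frac{(d-1)\pi^2}{4n^2}+\frac{(d-1)^2\pi^2}{4n^3}+O_d(n^{-4}).$$
   Context: All graphs are finite, undirected, simple and connected. For positive integers $n,d$, $\mathcal G(n,d)$ is the family of connected nonregular graphs of order $n$ and maximum degree $d$. For a graph $G$, $\lambda_1(G)$ is the largest eigenvalue of its adjacency matrix. Whenever $\mathcal G(n,d)\neq\varnothing$, $\rho(n,d):=\max\{\lambda_1(G):G\in\mathcal G(n,d)\}$. The notation $O_d(\cdot)$ means that the implicit constant may depend on $d$ only. *)

(* Defs.v *)
From HB Require Import structures.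
From mathcomp Require Export all_boot all_order all_algebra.
From mathcomp Require Export all_classical all_reals all_analysis.
Export Order.TTheory GRing.Theory Num.Theory numFieldNormedType.Exports.

Set Implicit Arguments.
Unset Strict Implicit.
Unset Printing Implicit Defensive.

Local Open Scope classical_set_scope.
Local Open Scope ring_scope.

Section Graphs.
Variable T : finType.
Implicit Type e : rel T.

Definition simple_graph e : Prop := symmetric e /\ irreflexive e.

Definition connected_graph e : Prop := forall x y : T, connect e x y.

Definition degree e (x : T) : nat := #|[set y | e x y]%SET|.

Definition max_degree e : nat := \max_(x : T) degree e x.

Definition regular_graph e : Prop := exists k : nat, forall x, degree e x = k.

End Graphs.

(* Graphs of order n are represented on the vertex set 'I_n. *)
Definition graph_family (n d : nat) : set (rel 'I_n) :=
  [set e | [/\ simple_graph e, connected_graph e,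
               ~ regular_graph e & max_degree e = d]].

Definition adjacency_matrix (R : realType) (n : nat) (e : rel 'I_n) : 'M[R]_n :=
  \matrix_(i, j) (e i j)%:R.

(* The greatest element of A; the default 0 is returned only if A has none. *)
Definition maximum (R : realType) (A : set R) : R := xget 0 (A `&` ubound A).

Definition lambda1 (R : realType) (n : nat) (e : rel 'I_n) : R :=
  maximum [set a | eigenvalue (adjacency_matrix R e) a].

Definition rho (R : realType) (n d : nat) : R :=
  maximum [set lambda1 R e | e in @graph_family n d].

(* Main.v *)
(* Write [mu = d - lambda1] and join every vertex [v] by [d - deg v] edges to an extra
   ground vertex, where functions vanish.

   Upper bound on [lambda1]. Sort the vertices by a nonnegative eigenvector [y], with gaps
   [D_k = y_(k+1) - y_k] and tail sums [S_k = y_(k+1) + ... + y_n]. The flux of [y] through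
   the [k]-th cut is [mu S_k], and summation by parts gives [sum S_k D_k = sum y_k^2]. The
   gap [D_t] contributes to the flux through the [j]-th cut once for each edge crossing
   both cuts, and since the graph is simple the number of edges crossing both the cuts
   [i + a] and [i + b] is at least [a (d + 1 - b) - c_i] for [a <= b], where [c_i] is the
   size of the [i]-th cut. Cuts of size at least [d - 1] are harmless; after a cut of size
   [1] the fluxes through the cuts [i], [i + 1], [i + d] control a window of [d + 1] gaps
   sharply; any other cut starts a window of [d] gaps with room to spare. Summing over
   windows bounds [sum y_k^2] by [mu / (d - 1)] times a quadratic form in [S] whose ground
   state is a sampled cosine of angle [pi / (2 n + d - 1)].

   Lower bound on [lambda1]. Chain copies of [K_(d+1)] minus an edge by bridges, ending in
   a block of odd order on one side and in a vertex of degree [d - 1] (or, for even order,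
   in a pendant vertex) on the other, and use the same cosine as a test function in the
   Rayleigh quotient. *)

Require Import Defs.
From mathcomp Require Import zify lra.

Set Implicit Arguments.
Unset Strict Implicit.
Unset Printing Implicit Defensive.

Local Open Scope classical_set_scope.
Local Open Scope ring_scope.

(** * Cuts of the level ordering *)

(* [W p q] is the number of edges between the levels [p] and [q]. Level 0 is the ground, which
   may be joined to a vertex by several edges; the vertices [1 .. n] are sorted by the
   eigenvector [y] of the Laplacian of the grounded graph. *)
Section Levels.
Variables (R : realFieldType) (n d : nat).
Variables (W : nat -> nat -> nat) (y : nat -> R) (mu : R).
Hypothesis W_sym : forall p q, W p q = W q p.
Hypothesis W_le1 : forall p q, (0 < p)%N -> (0 < q)%N -> (W p q <= 1)%N.
Hypothesis W_irr : forall p, W p p = 0%N.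
Hypothesis W_deg : forall p, (0 < p <= n)%N -> (\sum_(q < n.+1) W p q = d)%N.
Hypothesis y0 : y 0 = 0.
Hypothesis y_mono : forall k, (k < n)%N -> y k <= y k.+1.
Hypothesis y_eig : forall p, (0 < p <= n)%N ->
  \sum_(q < n.+1) (W p q)%:R * (y p - y q) = mu * y p.

(** Level [k] and everything below it form the lower side of the cut [k]. As [p <= t < q] forces
    [p < q], every edge is counted once, from its lower end. *)
Definition cross_both (t j : nat) : nat :=
  (\sum_(p < n.+1) \sum_(q < n.+1)
     W p q * ((p <= t < q) && (p <= j < q))%N)%N.

Definition cut_size (k : nat) : nat := cross_both k k.

Definition tail_sum (k : nat) : R := \sum_(k.+1 <= j < n.+1) y j.

Definition gap (k : nat) : R := y k.+1 - y k.

Local Notation N := cross_both.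
Local Notation S := tail_sum.

Lemma level_mono p q : (p <= q <= n)%N -> y p <= y q.
Proof.
move=> /andP[pq]; elim: q pq => [|q IH]; first by rewrite leqn0 => /eqP->.
rewrite leq_eqVlt => /predU1P[-> //|pq] qn.
by apply: le_trans (y_mono qn); apply: IH => //; exact: ltnW.
Qed.

Lemma level_ge0 p : (p <= n)%N -> 0 <= y p.
Proof. by move=> pn; rewrite -y0 level_mono. Qed.

Lemma gap_ge0 k : (k < n)%N -> 0 <= gap k.
Proof. by move=> kn; rewrite subr_ge0 y_mono. Qed.

Lemma tail_sumS k : (k < n)%N -> S k = y k.+1 + S k.+1.
Proof. by move=> kn; rewrite /tail_sum big_ltn. Qed.

Lemma tail_sum_end : S n = 0.
Proof. by rewrite /tail_sum big_geq. Qed.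

Lemma tail_sum_ge0 k : 0 <= S k.
Proof.
rewrite /tail_sum big_nat_cond; apply: sumr_ge0 => j /andP[/andP[_ jn] _].
exact: level_ge0.
Qed.

Lemma tail_sum_anti k l : (k <= l <= n)%N -> S l <= S k.
Proof.
move=> /andP[kl]; elim: l kl => [|l IH]; first by rewrite leqn0 => /eqP->.
rewrite leq_eqVlt => /predU1P[-> //|kl] ln.
apply: le_trans (IH kl (ltnW ln)).
by rewrite (tail_sumS ln) lerDr level_ge0.
Qed.

Lemma cross_bothC t j : N t j = N j t.
Proof. by apply: eq_bigr => p _; apply: eq_bigr => q _; rewrite andbC. Qed.

(** Summation by parts: the partial sums up to [m] differ by the boundary term [S m * y m], which
    vanishes at both ends because [y 0 = 0] and [S n = 0]. *)
Lemma sum_tail_gap : \sum_(0 <= k < n) S k * gap k = \sum_(0 <= k < n) y k.+1 ^+ 2.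
Proof.
suff H m : (m <= n)%N ->
    \sum_(0 <= k < m) S k * gap k = S m * y m + \sum_(0 <= k < m) y k.+1 ^+ 2.
  by rewrite H // tail_sum_end mul0r add0r.
elim: m => [_|m IH mn]; first by rewrite !big_geq // y0; lra.
by rewrite !big_nat_recr //= IH ?(ltnW mn) // (tail_sumS mn) /gap; lra.
Qed.

(* The edges inside the upper side of the cut cancel in pairs. *)
Lemma flux k : \sum_(p < n.+1) \sum_(q < n.+1)
  ((W p q)%:R * (p <= k < q)%N%:R) * (y q - y p) = mu * S k.
Proof.
pose G (q p : nat) : R := (W q p)%:R * (y q - y p).
have in0 : \sum_(q < n.+1) \sum_(p < n.+1)
    ((k < p) && (k < q))%N%:R * G q p = 0.
  set X := LHS.
  suff XN : X = - X by lra.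
  rewrite {1}/X exchange_big /= /X -sumrN; apply: eq_bigr => q _.
  rewrite -sumrN; apply: eq_bigr => p _.
  by rewrite /G W_sym andbC; lra.
rewrite -[LHS]addr0 -[X in _ + X]in0 exchange_big /= -big_split /=.
rewrite /tail_sum big_geq_mkord mulr_sumr [RHS]big_mkcond /=.
apply: eq_bigr => q _; rewrite -big_split /=.
case: ifP => kq; last first.
  by apply: big1 => p _; rewrite !andbF !(mulr0, mul0r) addr0.
rewrite -y_eig; last by rewrite (leq_trans _ kq) //= -ltnS.
apply: eq_bigr => p _; rewrite /G (W_sym p q) !andbT [(k < p)%N]ltnNge.
by case: leqP => _ /=; lra.
Qed.

(** All the gaps from [p] to [q] telescope to [y q - y p]; the range [[a, b)] only drops some of
    them, and gaps are nonnegative. *)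
Lemma sum_gap_sub p q a b : (p <= q <= n)%N -> (b <= n)%N ->
  \sum_(a <= t < b) gap t * (p <= t < q)%N%:R <= y q - y p.
Proof.
move=> /andP[pq qn] bn.
have -> : y q - y p = \sum_(0 <= t < n) gap t * (p <= t < q)%N%:R.
  rewrite (@big_cat_nat _ _ _ p) ?(leq_trans pq) //= (@big_cat_nat _ _ _ q p) //=.
  rewrite big_nat big1 ?add0r; last first.
    by move=> t /andP[_ tp]; rewrite [(p <= t)%N]leqNgt tp mulr0.
  rewrite [X in _ = _ + X]big_nat [X in _ = _ + X]big1 ?addr0; last first.
    by move=> t /andP[qt _]; rewrite [(t < q)%N]ltnNge qt andbF mulr0.
  by rewrite -telescope_sumr //; apply: eq_big_nat => t ->; rewrite mulr1.
have nng t : (t < n)%N -> 0 <= gap t * (p <= t < q)%N%:R.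
  by move=> tn; rewrite mulr_ge0 ?gap_ge0.
have [ab|ab] := leqP a b; last first.
  rewrite big_geq ?(ltnW ab) // big_nat; apply: sumr_ge0 => t /andP[_].
  exact: nng.
rewrite (@big_cat_nat _ _ _ a 0) ?(leq_trans ab) //=.
rewrite [X in _ <= _ + X](@big_cat_nat _ _ _ b a) //=.
rewrite addrCA lerDl addr_ge0 // big_nat; apply: sumr_ge0 => t /andP[t1 t2].
  by apply: nng; apply: leq_trans t2 _; apply: leq_trans bn.
exact: nng.
Qed.

(** After exchanging the sums, each edge crossing the cut [j] contributes only those of its gaps
    that lie in [[a, b)], hence at most its share of the flux. *)
Lemma sum_gap_cross a b j : (b <= n)%N ->
  \sum_(a <= t < b) gap t * (N t j)%:R <= mu * S j.
Proof.
move=> bn; rewrite -flux.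
under eq_bigr => t _.
  rewrite natr_sum mulr_sumr.
  under eq_bigr => p _ do rewrite natr_sum mulr_sumr.
  over.
rewrite exchange_big /=; apply: ler_sum => p _.
rewrite exchange_big /=; apply: ler_sum => q _.
have [/andP[pj jq]|_] /= := boolP (p <= j < q)%N; last first.
  by rewrite big1 ?mulr0 ?mul0r // => t _; rewrite andbF muln0 mulr0.
under eq_bigr => t _ do rewrite andbT natrM mulrCA.
rewrite -mulr_sumr mulr1; apply: ler_wpM2l => //.
apply: sum_gap_sub => //.
by rewrite (ltnW (leq_ltn_trans pj jq)) -ltnS ltn_ord.
Qed.

Lemma gap_cut k : (k < n)%N -> gap k * (cut_size k)%:R <= mu * S k.
Proof.
by move=> kn; have := @sum_gap_cross k k.+1 k kn; rewrite big_nat1.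
Qed.

Lemma sum_indic_itv i a : (i + a <= n)%N -> (\sum_(p < n.+1) (i < p <= i + a)%N = a)%N.
Proof.
move=> ian; rewrite -(big_mkord xpredT (fun p => (i < p <= i + a)%N : nat)).
rewrite (@big_cat_nat _ _ _ i.+1) //=; last by lia.
rewrite (@big_cat_nat _ _ _ (i + a).+1 i.+1) //=; try lia.
rewrite big_nat big1 ?add0n; last by move=> p; lia.
rewrite [X in (_ + X)%N]big_nat [X in (_ + X)%N]big1 ?addn0; last by move=> p; lia.
rewrite (eq_big_nat _ _ (F2 := fun=> 1%N)) ?sum_nat_const_nat; first by lia.
by move=> p; lia.
Qed.

(* Among the [a] vertices following the cut [i], each has at most [b - 1] neighbours
   among the [b] vertices following [i], and together they send at most [cut_size i]
   edges below [i]; all their other edges cross both cuts. *)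
Lemma cross_both_lower i a b : (a <= b)%N -> (i + b <= n)%N ->
  (a * d + a <= N (i + a) (i + b) + cut_size i + a * b)%N.
Proof.
move=> ab ibn.
have Ea := @sum_indic_itv i a; have Eb := @sum_indic_itv i b.
have -> : (a * d = \sum_(p < n.+1) \sum_(q < n.+1) W p q * (i < p <= i + a))%N.
  rewrite -{1}Ea; last lia.
  rewrite big_distrl /=; apply: eq_bigr => p _.
  rewrite -big_distrl /= mulnC; have [ip|] := boolP (i < p <= i + a)%N; last by rewrite !muln0.
  by rewrite W_deg //; lia.
have Ediag : (\sum_(p < n.+1) \sum_(q < n.+1) (i < p <= i + a) * (p == q) = a)%N.
  rewrite -[RHS]Ea; last lia.
  apply: eq_bigr => p _; rewrite -big_distrr /= (bigD1 p) //= eqxx big1 ?addn0 ?muln1 //.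
  by move=> q /negPf; rewrite eq_sym => ->.
have -> : (cut_size i = \sum_(p < n.+1) \sum_(q < n.+1) W q p * (q <= i < p))%N.
  by rewrite exchange_big; apply: eq_bigr => p _; apply: eq_bigr => q _; rewrite andbb.
have -> : (a * b = \sum_(p < n.+1) \sum_(q < n.+1) (i < p <= i + a) * (i < q <= i + b))%N.
  rewrite -{1}Ea; last lia.
  rewrite big_distrl; apply: eq_bigr => p _.
  by rewrite -big_distrr /= Eb.
rewrite -[X in (_ + X <= _)%N]Ediag -!big_split /=; apply: leq_sum => p _.
rewrite -!big_split /=; apply: leq_sum => q _.
have [/andP[ip pa]|_] := boolP (i < p <= i + a)%N; last by rewrite muln0 mul0n.
have [<-|pq] := eqVneq p q; first by rewrite W_irr; lia.
have := W_sym p q; have := @W_le1 p q.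
have [qi|iq] := leqP q i; first by rewrite ip; lia.
have [qb|bq] := leqP q (i + b); first by lia.
have -> : (p <= i + a < q)%N by lia.
have -> : (p <= i + b)%N by lia.
by lia.
Qed.

Lemma cross_both_lowerR i a b : (a <= b)%N -> (i + b <= n)%N ->
  a%:R * (d%:R + 1 - b%:R) - (cut_size i)%:R <= (N (i + a) (i + b))%:R :> R.
Proof.
move=> ab ibn; have := cross_both_lower ab ibn.
by rewrite -(ler_nat R) !natrD !natrM; lra.
Qed.

Lemma sum_nat_shift (F : nat -> R) i m :
  \sum_(i <= k < i + m) F k = \sum_(0 <= t < m) F (i + t)%N.
Proof.
by rewrite -{1}[i]add0n big_addn addKn; apply: eq_bigr => t _; rewrite addnC.
Qed.

(** Cauchy-Schwarz, by expanding the sum of squared deviations from the mean [t]. *)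
Lemma sqr_sum_nat (F : nat -> R) m :
  (\sum_(0 <= k < m) F k) ^+ 2 <= m%:R * \sum_(0 <= k < m) F k ^+ 2.
Proof.
case: m => [|m]; first by rewrite !big_geq // mul0r expr0n.
set X := \sum_(0 <= k < m.+1) F k; set Q := \sum_(0 <= k < m.+1) _.
have m0 : (0 : R) < m.+1%:R by rewrite ltr0n.
pose t := X / m.+1%:R.
have : 0 <= \sum_(0 <= k < m.+1) (F k - t) ^+ 2 by apply: sumr_ge0 => k _; exact: sqr_ge0.
have -> : \sum_(0 <= k < m.+1) (F k - t) ^+ 2 = Q - 2 * t * X + m.+1%:R * t ^+ 2.
  have -> : m.+1%:R * t ^+ 2 = \sum_(0 <= k < m.+1) t ^+ 2.
    by rewrite sumr_const_nat subn0 mulr_natl.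
  rewrite /Q /X mulr_sumr -sumrB -big_split /=; apply: eq_bigr => k _; lra.
have -> : Q - 2 * t * X + m.+1%:R * t ^+ 2 = Q - X ^+ 2 / m.+1%:R.
  rewrite /t; move: (m.+1%:R) m0 => M M0.
  have -> : M * (X / M) ^+ 2 = X ^+ 2 / M * (M / M) by lra.
  by rewrite divff ?gt_eqF //; lra.
by rewrite subr_ge0 ler_pdivrMr // mulrC.
Qed.

Lemma tail_sum_diff i m : (i + m <= n)%N ->
  S i - S (i + m) = \sum_(0 <= t < m) y (i + t).+1.
Proof.
elim: m => [|m IH imn]; first by rewrite addn0 subrr big_geq.
rewrite big_nat_recr //= -IH ?addnS; last by lia.
by rewrite (@tail_sumS (i + m)); [lra | lia].
Qed.

Lemma tail_sum_diff_sqr i m : (i + m <= n)%N ->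
  (S i - S (i + m)) ^+ 2 <= m%:R * \sum_(0 <= t < m) y (i + t).+1 ^+ 2.
Proof. by move=> imn; rewrite tail_sum_diff // sqr_sum_nat. Qed.

Lemma tail_sum_diff_le i m : (i + m <= n)%N -> S i - S (i + m) <= m%:R * y (i + m).
Proof.
move=> imn; rewrite tail_sum_diff // mulr_natl -[m in _ *+ m]subn0 -sumr_const_nat.
by rewrite big_nat [leRHS]big_nat; apply: ler_sum => t tm; apply: level_mono; lia.
Qed.

Lemma tail_sum_diff_ge i m : (i + m <= n)%N -> m%:R * y i <= S i - S (i + m).
Proof.
move=> imn; rewrite tail_sum_diff // mulr_natl -[m in _ *+ m]subn0 -sumr_const_nat.
by rewrite big_nat [leRHS]big_nat; apply: ler_sum => t tm; apply: level_mono; lia.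
Qed.

(** Concavity of [S]: its decrements are sums of [m] consecutive levels, and the levels are
    sorted. *)
Lemma tail_sum_diff_shift i j m : (i <= j)%N -> (j + m <= n)%N ->
  S i - S (i + m) <= S j - S (j + m).
Proof.
move=> ij jmn; rewrite !tail_sum_diff //; last by lia.
by rewrite big_nat [leRHS]big_nat; apply: ler_sum => t tm; apply: level_mono; lia.
Qed.

Lemma sum_gap i m : \sum_(0 <= t < m) gap (i + t) = y (i + m) - y i.
Proof.
elim: m => [|m IH]; first by rewrite addn0 subrr big_geq.
by rewrite big_nat_recr //= IH /gap addnS; lra.
Qed.

Lemma sum_gap_cross_shift i a b j : (i + b <= n)%N ->
  \sum_(a <= t < b) gap (i + t) * (N (i + t) j)%:R <= mu * S j.
Proof.
move=> ibn; have := @sum_gap_cross (a + i) (i + b) j ibn.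
rewrite big_addn addKn; apply: le_trans; apply: ler_sum => t _.
by rewrite addnC.
Qed.

(** * Windows of consecutive cuts *)

Hypothesis d_ge3 : (3 <= d)%N.
Hypothesis d_neq4 : d != 4%N.
Hypothesis mu_ge0 : 0 <= mu.
Hypothesis cut_size_gt0 : forall k, (k < n)%N -> (0 < cut_size k)%N.

Local Notation D := (d%:R).
(** One constant that dominates all lower-order coefficients arising in the windows; the factor 6
    matches the slack [1 / 6] in [window_drop]. *)
Local Notation C := (6 * (D + 1) ^+ 4).

(* The middle term telescopes over consecutive windows; it accounts for the cuts of size 1
   standing at the lower end of their windows, where the tail sums are largest. *)
Definition window_bound (a b : nat) : Prop :=
  (D - 1) * \sum_(a <= k < b) S k * gap k <=
  mu * ((1 + C * mu) * (\sum_(a <= k < b) S k ^+ 2)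
        + (D - 2) / 2 * (S a ^+ 2 - S b ^+ 2)
        + C * \sum_(a <= k < b) y k.+1 ^+ 2).

Lemma window_cat a b c : (a <= b <= c)%N ->
  window_bound a b -> window_bound b c -> window_bound a c.
Proof.
move=> /andP[ab bc] hab hbc; rewrite /window_bound.
rewrite !(@big_cat_nat _ _ _ b a c) //= mulrDr.
apply: le_trans (lerD hab hbc) _.
by rewrite le_eqVlt; apply/orP; left; apply/eqP; lra.
Qed.

Lemma D_ge3 : 3 <= D :> R. Proof. by rewrite (ler_nat _ 3). Qed.

Lemma C_ge (k : nat) : (k <= 4)%N -> (D + 1) ^+ k <= (D + 1) ^+ 4 :> R.
Proof. move=> k4; by have D3 := D_ge3; rewrite ler_weXn2l //; lra. Qed.

Lemma C_ge_half : (D - 2) / 2 * (D + 1) <= C :> R.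
Proof. by have C2 := @C_ge 2 isT; have D3 := D_ge3; nra. Qed.

Lemma C_ge_quartic : ((D - 1) * D) ^+ 2 <= C :> R.
Proof.
have D3 := D_ge3.
have E : (D + 1) ^+ 4 = ((D + 1) ^+ 2) ^+ 2 :> R by rewrite -exprM.
have H : ((D - 1) * D) ^+ 2 <= ((D + 1) ^+ 2) ^+ 2 :> R by rewrite ler_sqr ?nnegrE ?sqr_ge0 //; nra.
by have := sqr_ge0 ((D + 1) ^+ 2 : R); rewrite E; lra.
Qed.

Lemma C_ge_cube : 6 * D ^+ 2 * D <= C :> R.
Proof. by have C3 := @C_ge 3 isT; have D3 := D_ge3; nra. Qed.

Lemma gap_le_flux k : (k < n)%N -> gap k <= mu * S k.
Proof.
move=> kn; apply: le_trans (gap_cut kn).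
by rewrite ler_peMr ?gap_ge0 // ler1n cut_size_gt0.
Qed.

Lemma S_sqr_anti k l : (k <= l <= n)%N -> S l ^+ 2 <= S k ^+ 2.
Proof. by move=> kl; rewrite ler_sqr ?nnegrE ?tail_sum_ge0 // tail_sum_anti. Qed.

(** Isolates an error [e] of relative order [mu]. It is nonzero only for windows that start at a cut
    of size 1. *)
Lemma window_weaken a b e : (a <= b <= n)%N ->
  (D - 1) * \sum_(a <= k < b) S k * gap k <=
    mu * (\sum_(a <= k < b) S k ^+ 2 + (D - 2) / 2 * (S a ^+ 2 - S b ^+ 2)
          + C * \sum_(a <= k < b) y k.+1 ^+ 2 + e) ->
  e <= C * mu * \sum_(a <= k < b) S k ^+ 2 ->
  window_bound a b.
Proof.
move=> abn H He; apply: le_trans H _; apply: ler_wpM2l => //.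
rewrite -subr_ge0 in He; rewrite -subr_ge0; apply: le_trans He _.
by rewrite le_eqVlt; apply/orP; left; apply/eqP; lra.
Qed.

(** A cut crossed by at least [d - 1] edges already gives [(D - 1) * gap k <= mu * S k], so one gap
    forms a window. *)
Lemma window_single k : (k < n)%N -> (d <= (cut_size k).+1)%N -> window_bound k k.+1.
Proof.
have D3 := D_ge3; have mu0 := mu_ge0.
move=> kn dc; apply: (@window_weaken _ _ 0); first by lia.
  rewrite !big_nat1.
  have h1 : D - 1 <= (cut_size k)%:R :> R by rewrite lerBlDr natr1 ler_nat.
  have h2 := gap_cut kn.
  have h3 : 0 <= S k ^+ 2 - S k.+1 ^+ 2 by rewrite subr_ge0 S_sqr_anti //; lia.
  have S0 := tail_sum_ge0 k.
  have g0 := gap_ge0 kn.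
  apply: (@le_trans _ _ (mu * S k ^+ 2)).
    have : S k * (gap k * (D - 1)) <= S k * (mu * S k).
      by apply: ler_wpM2l => //; apply: le_trans h2; apply: ler_wpM2l.
    by lra.
  apply: ler_wpM2l => //; rewrite addr0 -addrA lerDl addr_ge0 //.
    by apply: mulr_ge0 => //; lra.
  by rewrite mulr_ge0 ?sqr_ge0 // mulr_ge0 // exprn_ge0 //; lra.
rewrite mulr_ge0 ?mulr_ge0 ?exprn_ge0 //; try lra.
by apply: sumr_ge0 => i _; exact: sqr_ge0.
Qed.

(** Since [S n = 0], Cauchy-Schwarz bounds [S i ^+ 2] by [D] times the sum of the last squares of
    [y], so the whole window fits into the [C] term. *)
Lemma window_tail i : (i <= n <= i + d)%N -> window_bound i n.
Proof.
have D3 := D_ge3; have mu0 := mu_ge0.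
move=> /andP[in_ nid]; apply: (@window_weaken _ _ 0); first by lia.
  pose T := \sum_(i <= k < n) y k.+1 ^+ 2.
  have T0 : 0 <= T by apply: sumr_ge0 => k _; exact: sqr_ge0.
  have Si : S i ^+ 2 <= D * T.
    have := @tail_sum_diff_sqr i (n - i); rewrite subnKC // => /(_ (leqnn _)).
    rewrite tail_sum_end subr0 => /le_trans; apply.
    have <- : T = \sum_(0 <= t < n - i) y (i + t).+1 ^+ 2.
      by rewrite -(sum_nat_shift (fun k => y k.+1 ^+ 2)) subnKC.
    apply: ler_wpM2r => //.
    by rewrite ler_nat; lia.
  have H : \sum_(i <= k < n) S k * gap k <= mu * (D ^+ 2 * T).
    have -> : mu * (D ^+ 2 * T) = D * (mu * (D * T)) by lra.
    apply: (@le_trans _ _ (\sum_(i <= k < n) mu * (D * T))).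
      rewrite big_nat [leRHS]big_nat; apply: ler_sum => k ikn.
      have kn : (k < n)%N by lia.
      have := gap_le_flux kn => /(ler_wpM2l (tail_sum_ge0 k)) /le_trans; apply.
      rewrite mulrCA; apply: ler_wpM2l => //; rewrite -expr2.
      by apply: le_trans Si; apply: S_sqr_anti; lia.
    rewrite sumr_const_nat -[leLHS]mulr_natl; apply: ler_wpM2r.
      by rewrite mulr_ge0 // mulr_ge0 //; lra.
    by rewrite ler_nat; lia.
  apply: (@le_trans _ _ (mu * (C * T))).
    apply: (@le_trans _ _ ((D - 1) * (mu * (D ^+ 2 * T)))).
      by apply: ler_wpM2l => //; lra.
    rewrite mulrCA; apply: ler_wpM2l => //; rewrite mulrA; apply: ler_wpM2r => //.
    by nra.
  apply: ler_wpM2l => //; rewrite addr0 lerDr addr_ge0 //.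
    by apply: sumr_ge0 => k _; exact: sqr_ge0.
  by rewrite mulr_ge0 ?subr_ge0 ?S_sqr_anti ?in_ ?leqnn //; lra.
rewrite mulr_ge0 ?mulr_ge0 ?exprn_ge0 //; try lra.
by apply: sumr_ge0 => k _; exact: sqr_ge0.
Qed.

(** Concavity gives [X t + X (d + 1 - t) <= X (d + 1)], so the [d - 2] terms average to at most half
    of [X (d + 1)]. The right-hand side is [(D - 2) * S i * X (d + 1)] written with squares. *)
Lemma sum_sqr_defect i : (i + d.+1 <= n)%N ->
  \sum_(2 <= t < d) (S i ^+ 2 - S (i + t) ^+ 2) <=
  (D - 2) / 2 * (S i ^+ 2 - S (i + d.+1) ^+ 2 + (S i - S (i + d.+1)) ^+ 2).
Proof.
move=> idn; have d3 := d_ge3; have S0 := tail_sum_ge0 i.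
pose X t := S i - S (i + t).
have XD : 2 * \sum_(2 <= t < d) X t <= (D - 2) * X d.+1.
  have -> : 2 * \sum_(2 <= t < d) X t = \sum_(2 <= t < d) (X t + X (d.+1 - t)%N).
    have E : \sum_(2 <= t < d) X t = \sum_(2 <= t < d) X (d.+1 - t)%N.
      by rewrite big_nat_rev; apply: eq_big_nat => t td; congr X; lia.
    transitivity (\sum_(2 <= t < d) X t + \sum_(2 <= t < d) X (d.+1 - t)%N).
      by rewrite -E; lra.
    by rewrite -big_split.
  have -> : (D - 2) * X d.+1 = \sum_(2 <= t < d) X d.+1.
    by rewrite sumr_const_nat -[RHS]mulr_natl natrB //; lia.
  rewrite big_nat [leRHS]big_nat; apply: ler_sum => t td.
  have := @tail_sum_diff_shift i (i + (d.+1 - t)) t (leq_addr _ _).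
  have -> : (i + (d.+1 - t) + t = i + d.+1)%N by lia.
  by rewrite /X => /(_ idn); lra.
apply: (@le_trans _ _ (S i * (2 * \sum_(2 <= t < d) X t))).
  rewrite !mulr_sumr; apply: ler_sum => t _.
  have -> : S i ^+ 2 - S (i + t) ^+ 2 = S i * (2 * X t) - X t ^+ 2 by rewrite /X; lra.
  by rewrite gerBl sqr_ge0.
apply: le_trans (ler_wpM2l S0 XD) _.
by rewrite /X; lra.
Qed.

(* Every gap [i + t] is crossed by [d - t] edges together with the cut [i + 1] and by
   [t - 1] edges together with the cut [i + d]. As the tail sums interpolate almost
   linearly, the weighted count is exact up to an error of order [mu]. *)
Lemma bridge_flux i : (i + d.+1 <= n)%N -> cut_size i = 1%N ->
  (D - 1) * \sum_(1 <= t < d.+1) S (i + t) * gap (i + t) <=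
  mu * (S (i + 1) ^+ 2 + S (i + d) ^+ 2) + (D - 1) ^+ 2 * (D * (mu * S i)) ^+ 2.
Proof.
move=> idn c1; have d3 := d_ge3; have D3 := D_ge3; have mu0 := mu_ge0.
have g0 t : (t <= d)%N -> 0 <= gap (i + t) by move=> td; apply: gap_ge0; lia.
have gS t : (t <= d)%N -> gap (i + t) <= mu * S i.
  move=> td; apply: le_trans (gap_le_flux _) _; first by lia.
  by apply: ler_wpM2l => //; apply: tail_sum_anti; lia.
have flux1 : \sum_(1 <= t < d.+1) gap (i + t) * (D - t%:R) <= mu * S (i + 1).
  apply: le_trans (sum_gap_cross_shift 1 (i + 1) idn); apply: ler_sum_nat => t td.
  apply: ler_wpM2l; first by apply: g0; lia.
  rewrite cross_bothC; have := @cross_both_lowerR i 1 t.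
  by rewrite c1 => H; apply: le_trans (H _ _); [lra | lia | lia].
have fluxd : \sum_(1 <= t < d.+1) gap (i + t) * (t%:R - 1) <= mu * S (i + d).
  apply: le_trans (sum_gap_cross_shift 1 (i + d) idn); apply: ler_sum_nat => t td.
  apply: ler_wpM2l; first by apply: g0; lia.
  have := @cross_both_lowerR i t d.
  by rewrite c1 => H; apply: le_trans (H _ _); [lra | lia | lia].
(* Concavity puts [S] above its chord. It exceeds the chord by an amount governed by the spread
   [y (i + d) - y i], which is at most [d] gaps of size [mu * S i]. *)
have interp t : (1 <= t <= d)%N -> (D - 1) * S (i + t) <=
    (D - t%:R) * S (i + 1) + (t%:R - 1) * S (i + d) + (D - 1) ^+ 2 * (D * (mu * S i)).
  move=> /andP[t1 td].
  have G0 : 0 <= y (i + d) - y i by rewrite subr_ge0; apply: level_mono; lia.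
  have G : y (i + d) - y i <= D * (mu * S i).
    rewrite -sum_gap (_ : D * _ = \sum_(0 <= t < d) mu * S i); last first.
      by rewrite sumr_const_nat subn0 mulr_natl.
    by rewrite big_nat [leRHS]big_nat; apply: ler_sum => s sd; apply: gS; lia.
  have A : (t%:R - 1) * y i <= S (i + 1) - S (i + t).
    have := @tail_sum_diff_ge (i + 1) (t - 1); rewrite (_ : (i + 1 + (t - 1) = i + t)%N); last lia.
    rewrite natrB // => H; apply: le_trans (H _); last lia.
    by apply: ler_wpM2l; [rewrite subr_ge0 ler1n | apply: level_mono; lia].
  have B : S (i + 1) - S (i + d) <= (D - 1) * y (i + d).
    have := @tail_sum_diff_le (i + 1) (d - 1); rewrite (_ : (i + 1 + (d - 1) = i + d)%N); last lia.
    by rewrite natrB //; [apply; lia | lia].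
  have tR1 : 0 <= (t%:R : R) - 1 by rewrite subr_ge0 ler1n.
  have tRd : (t%:R : R) - 1 <= D - 1 by rewrite lerD2r ler_nat.
  have B' := ler_wpM2l tR1 B.
  have A' : (D - 1) * ((t%:R - 1) * y i) <= (D - 1) * (S (i + 1) - S (i + t)).
    by apply: ler_wpM2l => //; lra.
  have G' : (t%:R - 1) * (D - 1) * (y (i + d) - y i) <= (D - 1) ^+ 2 * (D * (mu * S i)).
    rewrite expr2; apply: ler_pM => //; first by rewrite mulr_ge0 //; lra.
    by apply: ler_wpM2r => //; lra.
  by lra.
have G : \sum_(1 <= t < d.+1) gap (i + t) <= D * (mu * S i).
  rewrite (_ : D * _ = \sum_(1 <= t < d.+1) mu * S i); last first.
    by rewrite sumr_const_nat subn1 mulr_natl.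
  by rewrite big_nat [leRHS]big_nat; apply: ler_sum => s sd; apply: gS; lia.
set E := (D - 1) ^+ 2 * (D * (mu * S i)) in interp.
have E0 : 0 <= E by rewrite mulr_ge0 ?sqr_ge0 // mulr_ge0 ?mulr_ge0 ?tail_sum_ge0 //; lra.
apply: (@le_trans _ _ (S (i + 1) * (mu * S (i + 1)) + S (i + d) * (mu * S (i + d))
    + E * (D * (mu * S i)))); last first.
  by rewrite /E; lra.
apply: le_trans (lerD (lerD (ler_wpM2l (tail_sum_ge0 (i + 1)) flux1)
  (ler_wpM2l (tail_sum_ge0 (i + d)) fluxd)) (ler_wpM2l E0 G)).
rewrite !mulr_sumr -!big_split /=; apply: ler_sum_nat => t td.
have H := ler_wpM2l (g0 t ltac:(lia)) (interp t ltac:(lia)).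
rewrite mulrA mulrC; apply: le_trans H _.
by rewrite le_eqVlt; apply/orP; left; apply/eqP; lra.
Qed.

(** The gap at the bridge costs [(D - 1) * mu * S i ^+ 2], the other [d] gaps cost
    [mu * (S (i + 1) ^+ 2 + S (i + d) ^+ 2)]. These are [d + 1] squares as required, but [d - 2] of
    them are taken at [i] instead of [i + t]; the telescoping term of [window_bound] pays for this
    defect. *)
Lemma window_bridge i : (i + d.+1 <= n)%N -> cut_size i = 1%N -> window_bound i (i + d.+1).
Proof.
move=> idn c1; have d3 := d_ge3; have D3 := D_ge3; have mu0 := mu_ge0.
have S0 := tail_sum_ge0 i.
have Y0 : 0 <= \sum_(i <= k < i + d.+1) y k.+1 ^+ 2 by apply: sumr_ge0 => k _; exact: sqr_ge0.
apply: (@window_weaken _ _ (C * mu * S i ^+ 2)); first by lia.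
  have splitF (F : nat -> R) : \sum_(i <= k < i + d.+1) F k =
      F i + \sum_(1 <= t < d.+1) F (i + t)%N.
    by rewrite sum_nat_shift big_ltn // addn0.
  rewrite [X in _ * X <= _]splitF mulrDr.
  have h1 : S i * gap i <= mu * S i ^+ 2.
    by have := ler_wpM2l S0 (@gap_le_flux i ltac:(lia)); lra.
  have h1' : (D - 1) * (S i * gap i) <= (D - 1) * (mu * S i ^+ 2) by apply: ler_wpM2l => //; lra.
  have h2 := bridge_flux idn c1.
  have h3 := ler_wpM2l mu0 (sum_sqr_defect idn).
  have h4 : \sum_(i <= k < i + d.+1) S k ^+ 2 =
     (D - 1) * S i ^+ 2 + S (i + 1) ^+ 2 + S (i + d) ^+ 2
       - \sum_(2 <= t < d) (S i ^+ 2 - S (i + t) ^+ 2).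
    have -> : \sum_(i <= k < i + d.+1) S k ^+ 2 =
        S i ^+ 2 + (S (i + 1) ^+ 2 + (\sum_(2 <= t < d) S (i + t) ^+ 2 + S (i + d) ^+ 2)).
      rewrite splitF; congr (_ + _).
      rewrite [LHS]big_ltn; last by lia.
      congr (_ + _).
      by rewrite [LHS]big_nat_recr //=; lia.
    by rewrite sumrB sumr_const_nat -[X in _ - (X - _)]mulr_natl natrB; [lra | lia].
  have h5 : (D - 2) / 2 * (S i - S (i + d.+1)) ^+ 2 <= C * \sum_(i <= k < i + d.+1) y k.+1 ^+ 2.
    have := @tail_sum_diff_sqr i d.+1 idn.
    rewrite -(sum_nat_shift (fun k => y k.+1 ^+ 2)) => H.
    apply: (@le_trans _ _ ((D - 2) / 2 * (d.+1%:R * \sum_(i <= k < i + d.+1) y k.+1 ^+ 2))).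
      by apply: ler_wpM2l; [lra | exact: H].
    rewrite mulrA; apply: ler_wpM2r => //.
    by rewrite -[d.+1%:R]natr1; exact: C_ge_half.
  have h5' := ler_wpM2l mu0 h5.
  have h6 : (D - 1) ^+ 2 * (D * (mu * S i)) ^+ 2 <= mu * (C * mu * S i ^+ 2).
    have -> : (D - 1) ^+ 2 * (D * (mu * S i)) ^+ 2 =
        mu * ((((D - 1) * D) ^+ 2) * (mu * S i ^+ 2)) by lra.
    rewrite -[C * mu * _]mulrA; apply: ler_wpM2l => //; apply: ler_wpM2r.
      by rewrite mulr_ge0 ?sqr_ge0.
    exact: C_ge_quartic.
  by rewrite h4; lra.
apply: ler_wpM2l; first by rewrite mulr_ge0 // mulr_ge0 // exprn_ge0 //; lra.
rewrite big_ltn ?lerDl; last by lia.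
by apply: sumr_ge0 => k _; exact: sqr_ge0.
Qed.

(** Let [c] be the size of the cut [i] and [F = mu * S i]. The cut [i] gives [gap i <= F / c], the
    cut [i + 1] gives [gap (i + 1) <= F / (d - c)]. The cuts [i + 2] and [i + d - 1] share with the
    cut [i + t] at least [2 (d + 1 - t) - c] and [2 t - c] edges; [t] cancels in the sum, and the
    remaining gaps add up to at most [F / (d + 1 - c)]. *)
Lemma window_drop i : (i + d <= n)%N -> (2 <= cut_size i)%N -> (cut_size i + 2 <= d)%N ->
  (D - 1) * \sum_(0 <= t < d) gap (i + t) <= (D - 1 / 6) * (mu * S i).
Proof.
move=> idn c2 cd; have d3 := d_ge3; have mu0 := mu_ge0.
have FS t : (t <= d)%N -> mu * S (i + t) <= mu * S i.
  by move=> td; apply: ler_wpM2l => //; apply: tail_sum_anti; lia.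
have g_ge0 t : (t < d)%N -> 0 <= gap (i + t) by move=> td; apply: gap_ge0; lia.
have h0 : gap i * (cut_size i)%:R <= mu * S i by apply: gap_cut; lia.
have h1 : gap (i + 1) * (D - (cut_size i)%:R) <= mu * S i.
  apply: le_trans (FS 1%N _); last lia.
  apply: le_trans (gap_cut _); last lia.
  apply: ler_wpM2l; first by apply: g_ge0; lia.
  by apply: le_trans (cross_both_lowerR _ _); [lra | lia | lia].
have h2 : (\sum_(2 <= t < d) gap (i + t)) * (D + 1 - (cut_size i)%:R) <= mu * S i.
  have k1 := @sum_gap_cross_shift i 2 d (i + 2) idn.
  have k2 := @sum_gap_cross_shift i 2 d (i + (d - 1)) idn.
  have : (\sum_(2 <= t < d) gap (i + t)) * (2 * (D + 1 - (cut_size i)%:R)) <=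
      mu * S (i + 2) + mu * S (i + (d - 1)).
    apply: le_trans (lerD k1 k2); rewrite mulr_suml -big_split /=.
    apply: ler_sum_nat => t td; rewrite -mulrDr; apply: ler_wpM2l; first by apply: g_ge0; lia.
    have := @cross_both_lowerR i 2 t; rewrite [N (i + 2) _]cross_bothC.
    move=> /(_ ltac:(lia) ltac:(lia)).
    have := @cross_both_lowerR i t (d - 1) => /(_ ltac:(lia) ltac:(lia)).
    rewrite natrB; last lia.
    lra.
  have := FS 2 ltac:(lia); have := FS (d - 1)%N ltac:(lia); lra.
have -> : \sum_(0 <= t < d) gap (i + t) = gap i + gap (i + 1) + \sum_(2 <= t < d) gap (i + t).
  rewrite big_ltn; last lia.
  rewrite big_ltn; last lia.
  by rewrite addn0 addrA.
have G0 : 0 <= \sum_(2 <= t < d) gap (i + t).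
  by rewrite big_nat; apply: sumr_ge0 => t td; apply: g_ge0; lia.
have g0 : 0 <= gap i by rewrite -[i]addn0; apply: g_ge0; lia.
have g1 : 0 <= gap (i + 1) by apply: g_ge0; lia.
have F0 : 0 <= mu * S i by rewrite mulr_ge0 ?tail_sum_ge0.
have dE : D = (d - cut_size i - 2)%:R + (cut_size i)%:R + 2 :> R.
  by rewrite -!natrD; congr _%:R; lia.
have cE : (cut_size i)%:R = (cut_size i - 2)%:R + 2 :> R by rewrite -natrD; congr _%:R; lia.
(* Here [d != 4] enters: for [d = 4] and a cut of size 2 both differences vanish and the three
   estimates add up to [D * F], without slack. *)
have uv : 1 <= (cut_size i - 2)%:R + (d - cut_size i - 2)%:R :> R.
  by rewrite -natrD ler1n; have := d_neq4; lia.
have u0 : 0 <= (cut_size i - 2)%:R :> R by [].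
have v0 : 0 <= (d - cut_size i - 2)%:R :> R by [].
move: h0 h1 h2 uv u0 v0; rewrite dE cE.
move: ((cut_size i - 2)%:R) ((d - cut_size i - 2)%:R) (gap i) (gap (i + 1))
  (\sum_(_ <= _ < _) _) (mu * S i) g0 g1 G0 F0.
move=> u v a b G F a0 b0 G0 F0 h0 h1 h2 uv u0 v0.
have ha : a <= F / 2 by have := mulr_ge0 a0 u0; lra.
have hb : b <= F / 2 by have := mulr_ge0 b0 v0; lra.
have hG : G <= F / 3 by have := mulr_ge0 G0 v0; lra.
have ha' := ler_wpM2l v0 ha.
have hb' := ler_wpM2l u0 hb.
have hG' := ler_wpM2l u0 hG.
have hF : F * 1 <= F * (u + v) by apply: ler_wpM2l.
have hF' : 0 <= F * v by apply: mulr_ge0.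
lra.
Qed.

Lemma window_middle i : (i + d <= n)%N -> (2 <= cut_size i)%N -> (cut_size i + 2 <= d)%N ->
  window_bound i (i + d).
Proof.
move=> idn c2 cd; have d3 := d_ge3; have mu0 := mu_ge0; have D3 := D_ge3.
have S0 := tail_sum_ge0 i.
have Y0 : 0 <= \sum_(i <= k < i + d) y k.+1 ^+ 2 by apply: sumr_ge0 => k _; exact: sqr_ge0.
apply: (@window_weaken _ _ 0); first by lia.
  apply: (@le_trans _ _ (S i * ((D - 1 / 6) * (mu * S i)))).
    apply: le_trans (ler_wpM2l S0 (window_drop idn c2 cd)).
    rewrite mulrCA; apply: ler_wpM2l; first lra.
    rewrite sum_nat_shift mulr_sumr; apply: ler_sum_nat => t td.
    apply: ler_wpM2r; first by apply: gap_ge0; lia.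
    by apply: tail_sum_anti; lia.
  have -> : S i * ((D - 1 / 6) * (mu * S i)) = mu * ((D - 1 / 6) * S i ^+ 2) by lra.
  apply: ler_wpM2l => //; rewrite addr0.
  set X := S i - S (i + d).
  have hS : D * (S i ^+ 2 - 2 * S i * X) <= \sum_(i <= k < i + d) S k ^+ 2.
    rewrite sum_nat_shift (_ : D * _ = \sum_(0 <= t < d) (S i ^+ 2 - 2 * S i * X)); last first.
      by rewrite sumr_const_nat subn0 mulr_natl.
    apply: ler_sum_nat => t td.
    have a1 : S (i + d) <= S (i + t) by apply: tail_sum_anti; lia.
    have a2 : S (i + t) <= S i by apply: tail_sum_anti; lia.
    have a3 := sqr_ge0 (S i - S (i + t)).
    have a4 : S i * (S i - S (i + t)) <= S i * X by apply: ler_wpM2l => //; rewrite /X; lra.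
    lra.
  have hX := tail_sum_diff_sqr idn; rewrite -(sum_nat_shift (fun k => y k.+1 ^+ 2)) -/X in hX.
  have hA : 0 <= (D - 2) / 2 * (S i ^+ 2 - S (i + d) ^+ 2).
    by rewrite mulr_ge0 ?subr_ge0 ?S_sqr_anti //; [lra | lia].
  (* The slack [1 / 6] absorbs the cost of replacing every [S k] in the window by [S i]. *)
  have hsq : D * (2 * S i * X) <= S i ^+ 2 / 6 + 6 * D ^+ 2 * X ^+ 2.
    by have := sqr_ge0 (S i - 6 * D * X); lra.
  have hC : 6 * D ^+ 2 * X ^+ 2 <= C * \sum_(i <= k < i + d) y k.+1 ^+ 2.
    apply: (@le_trans _ _ (6 * D ^+ 2 * (D * \sum_(i <= k < i + d) y k.+1 ^+ 2))).
      by apply: ler_wpM2l => //; rewrite mulr_ge0 ?sqr_ge0.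
    by rewrite mulrA; apply: ler_wpM2r => //; exact: C_ge_cube.
  lra.
rewrite mulr_ge0 ?mulr_ge0 ?exprn_ge0 //; try lra.
by apply: sumr_ge0 => k _; exact: sqr_ge0.
Qed.

(** Greedy partition from below: the size of the cut [i] decides whether the next window has 1,
    [d + 1] or [d] gaps, until at most [d] gaps are left. *)
Lemma window_all : window_bound 0 n.
Proof.
have d3 := d_ge3.
suff H m i : (n - i <= m)%N -> (i <= n)%N -> window_bound i n by apply: (H n) => //; rewrite subn0.
elim: m i => [|m IH] i nim in_.
  by apply: window_tail; lia.
have [nid|idn] := leqP n (i + d); first by apply: window_tail; lia.
have c0 := @cut_size_gt0 i ltac:(lia).
have [dc|cd] := leqP d (cut_size i).+1.
  by apply: (window_cat (b := i.+1)); [lia | by apply: window_single; lia | by apply: IH; lia].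
have [c1|c2] := leqP (cut_size i) 1.
  by apply: (window_cat (b := (i + d.+1)%N));
    [lia | apply: window_bridge; first lia | by apply: IH; lia]; lia.
by apply: (window_cat (b := (i + d)%N)); [lia | by apply: window_middle; lia | by apply: IH; lia].
Qed.

Lemma level_bound :
  (D - 1) * \sum_(0 <= k < n) y k.+1 ^+ 2 <=
  mu * ((1 + C * mu) * (\sum_(0 <= k < n) S k ^+ 2) + (D - 2) / 2 * S 0 ^+ 2
        + C * \sum_(0 <= k < n) y k.+1 ^+ 2).
Proof.
by have := window_all; rewrite /window_bound sum_tail_gap tail_sum_end expr0n /= subr0.
Qed.

End Levels.

(** * Trigonometric estimates *)

Section Trigonometry.
Variable R : realType.
Implicit Types x t : R.

Lemma sin_mean x : 0 < x -> exists2 c, 0 < c < x & sin x = x * cos c.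
Proof.
move=> x0.
have [c] := @MVT R sin cos 0 x x0 (fun z _ => is_derive_sin z)
  (continuous_subspaceT (@continuous_sin R)).
rewrite in_itv /= sin0 !subr0 mulrC => c0x ->.
by exists c.
Qed.

Lemma sin_le_id x : 0 <= x -> sin x <= x.
Proof.
rewrite le_eqVlt => /predU1P[<-|x0]; first by rewrite sin0.
by have [c _ ->] := sin_mean x0; rewrite ger_pMr // cos_le1.
Qed.

Lemma sin_sqr_le x : sin x ^+ 2 <= x ^+ 2.
Proof.
wlog x0 : x / 0 <= x.
  move=> H; have [/H//|/ltW] := leP 0 x; rewrite -oppr_ge0 => /H.
  by rewrite sinN !sqrrN.
have [x1|x1] := leP x 1.
  rewrite ler_sqr ?nnegrE // ?sin_le_id // sin_ge0_pi // x0 /=.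
  by apply: le_trans x1 _; apply: le_trans (pi_ge2 R); rewrite ler1n.
apply: (@le_trans _ _ 1); last by rewrite exprn_ege1 // ltW.
by have := cos2Dsin2 x; have := sqr_ge0 (cos x); lra.
Qed.

Lemma cos_double x : cos (2 * x) = 1 - 2 * sin x ^+ 2.
Proof. by rewrite -mulrC mulr_natr cos_mulr2n cos2sin2; lra. Qed.

Lemma cos_half x : cos x = 1 - 2 * sin (x / 2) ^+ 2.
Proof. by rewrite -cos_double mulrCA divff ?mulr1. Qed.

Lemma cos_ge x : 1 - x ^+ 2 / 2 <= cos x.
Proof. by have := sin_sqr_le (x / 2); rewrite (cos_half x); lra. Qed.

Lemma sin_ge x : 0 <= x -> x - x ^+ 3 / 2 <= sin x.
Proof.
rewrite le_eqVlt => /predU1P[<-|x0]; first by rewrite sin0; lra.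
have [c /andP[c0 cx] ->] := sin_mean x0.
have : c ^+ 2 <= x ^+ 2 by rewrite ler_sqr ?nnegrE //; lra.
have := cos_ge c => h1 h2.
apply: (@le_trans _ _ (x * (1 - x ^+ 2 / 2))); first by lra.
by apply: ler_wpM2l; lra.
Qed.

End Trigonometry.

(** * A discrete Wirtinger inequality with a weighted free end *)

Section Wirtinger.
Variables (R : realType) (n h : nat).
Hypothesis n_gt0 : (0 < n)%N.

Let t : R := pi / 2 / (n + h)%:R.
Let nu : R := 2 - 2 * cos t.
Let phi (k : nat) : R := cos (k%:R * t).

Let t_gt0 : 0 < t.
Proof. by rewrite !divr_gt0 ?pi_gt0 // ltr0n; lia. Qed.

Let phi_end : phi (n + h) = 0.
Proof.
rewrite /phi /t mulrCA divff ?mulr1 ?cos_pihalf // pnatr_eq0; lia.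
Qed.

Let angle_le k : (k <= n + h)%N -> 0 <= k%:R * t <= pi / 2.
Proof.
move=> knh; rewrite mulr_ge0 ?(ltW t_gt0) //=.
have -> : pi / 2 = (n + h)%:R * t.
  by rewrite /t mulrCA divff ?mulr1 // pnatr_eq0; lia.
by apply: ler_wpM2r; rewrite ?ler_nat // ltW.
Qed.

Let phi_gt0 k : (k < n + h)%N -> 0 < phi k.
Proof.
move=> knh; apply: cos_gt0_pihalf.
have /andP[k0 k1] := @angle_le k (ltnW knh).
have /andP[_ k2] := @angle_le k.+1 knh.
have tp := t_gt0; have pp := pi_gt0 R.
by move: k2; rewrite -natr1 mulrDl mul1r => k2; apply/andP; split; lra.
Qed.

Let phi_rec k : phi k + phi k.+2 = (2 - nu) * phi k.+1.
Proof.
have -> : phi k = cos (k.+1%:R * t - t) by congr cos; rewrite -natr1; lra.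
have -> : phi k.+2 = cos (k.+1%:R * t + t) by congr cos; rewrite -[k.+2%:R]natr1; lra.
by rewrite cosB cosD /phi /nu; lra.
Qed.

Let phi_anti k : (k < n + h)%N -> phi k.+1 <= phi k.
Proof.
move=> knh; rewrite /phi -natr1 mulrDl mul1r cosD.
have a := @angle_le k (ltnW knh); have b : 0 <= t <= pi / 2.
  by have := @angle_le 1; rewrite mul1r; apply; lia.
have pp := pi_gt0 R.
have s1 : 0 <= sin (k%:R * t) by apply: sin_ge0_pi; lra.
have s2 : 0 <= sin t by apply: sin_ge0_pi; lra.
have c1 : 0 <= cos (k%:R * t) by apply: cos_ge0_pihalf; lra.
have := mulr_ge0 s1 s2; have := ler_piMr c1 (cos_le1 t); lra.
Qed.

(** Summing the recurrence gives [phi k - phi (k + 1) = nu * (phi 0 / 2 + phi 1 + ... + phi k)], and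
    [phi] decreases. At [k = h] this produces the weight [h + 1 / 2] of [S 0 ^+ 2]. *)
Let phi_defect k : (k < n + h)%N -> nu * (1 / 2 + k%:R) * phi k <= phi k - phi k.+1.
Proof.
have nu0 : 0 <= nu by rewrite /nu; have := cos_le1 t; lra.
elim: k => [|k IH] knh.
  by rewrite /phi mul0r cos0 (_ : 1%:R * t = t) ?mul1r // /nu; lra.
have H := IH (ltnW knh).
have H1 := phi_rec k.
have := ler_wpM2l (mulr_ge0 nu0 (_ : 0 <= 1 / 2 + k%:R)) (phi_anti (ltnW knh)).
rewrite -[k.+1%:R]natr1 => /(_ ltac:(by rewrite addr_ge0)); lra.
Qed.

(* Picone's argument with the comparison function [cos ((h + k) t)], which vanishes at
   [k = n]. *)
Lemma wirtinger (S : nat -> R) : S n = 0 ->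
  nu * (\sum_(0 <= k < n) S k ^+ 2 + (h%:R - 1 / 2) * S 0 ^+ 2) <=
  \sum_(0 <= k < n) (S k - S k.+1) ^+ 2.
Proof.
move=> Sn.
(* The extra term carries the ratio of consecutive values of [phi]. At [m = n - 1] the ratio is 0
   and the term becomes the last square, as [S n = 0]. *)
suff H m : (m < n)%N ->
    nu * (\sum_(0 <= k < m.+1) S k ^+ 2 + (h%:R - 1 / 2) * S 0 ^+ 2) <=
    \sum_(0 <= k < m) (S k - S k.+1) ^+ 2 + S m ^+ 2 * (1 - phi (h + m).+1 / phi (h + m)).
  have En : n.-1.+1 = n by lia.
  have := H n.-1 ltac:(lia); rewrite -addnS En [(h + n)%N]addnC phi_end mul0r subr0 mulr1.
  move=> /le_trans; apply.
  by rewrite -[X in _ <= \sum_(0 <= k < X) _]En big_nat_recr //= En Sn subr0.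
elim: m => [|m IH] mn.
  rewrite big_nat1 big_geq // add0r addn0.
  have p0 : 0 < phi h by apply: phi_gt0; lia.
  have := @phi_defect h ltac:(lia).
  have -> : 1 - phi h.+1 / phi h = (phi h - phi h.+1) / phi h by rewrite mulrBl divff ?gt_eqF.
  rewrite -ler_pdivlMr // => /(ler_wpM2l (sqr_ge0 (S 0))); lra.
have {}IH := IH (ltnW mn).
rewrite big_nat_recr //= [X in _ <= X + _]big_nat_recr //=.
have p0 : 0 < phi (h + m) by apply: phi_gt0; lia.
have p1 : 0 < phi (h + m.+1) by apply: phi_gt0; lia.
have E := phi_rec (h + m); rewrite -!addnS in E IH *.
have Er : 1 - phi (h + m.+2) / phi (h + m.+1) = nu - 1 + phi (h + m) / phi (h + m.+1).
  have -> : phi (h + m.+2) = (2 - nu) * phi (h + m.+1) - phi (h + m) by lra.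
  by rewrite mulrBl mulfK ?gt_eqF //; lra.
rewrite {}Er; set r := phi (h + m.+1) / phi (h + m) in IH *.
have r0 : 0 < r by rewrite divr_gt0.
have -> : phi (h + m) / phi (h + m.+1) = r^-1 by rewrite invf_div.
have : 0 <= r * (S m - r^-1 * S m.+1) ^+ 2 by rewrite mulr_ge0 ?sqr_ge0 ?ltW.
have -> : r * (S m - r^-1 * S m.+1) ^+ 2 =
    r * S m ^+ 2 - 2 * (r / r) * S m * S m.+1 + (r / r) * r^-1 * S m.+1 ^+ 2 by lra.
by rewrite divff ?gt_eqF //; lra.
Qed.

End Wirtinger.

Lemma wirtinger_rate_bounds (R : realType) (t : R) : 0 <= t <= 2 ->
  t ^+ 2 - t ^+ 4 <= 2 - 2 * cos t <= t ^+ 2.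
Proof.
move=> /andP[t0 t2]; have := cos_ge t; rewrite (cos_half t) => h.
have s1 := @sin_ge R (t / 2) ltac:(lra).
have e : 0 <= t / 2 - (t / 2) ^+ 3 / 2.
  by have := mulr_ge0 t0 t0; nra.
have : (t / 2 - (t / 2) ^+ 3 / 2) ^+ 2 <= sin (t / 2) ^+ 2.
  by rewrite ler_sqr ?nnegrE //; lra.
have t4 : 0 <= t ^+ 4 by rewrite exprn_ge0.
have t6 : 0 <= t ^+ 6 by rewrite exprn_ge0.
by lra.
Qed.

(** * Lower bound on [mu] *)

Section GapLowerBound.
Variables (R : realType) (n h : nat).
Variables (W : nat -> nat -> nat) (y : nat -> R) (mu : R).
Let d := h.*2.+1.
Hypothesis W_sym : forall p q, W p q = W q p.
Hypothesis W_le1 : forall p q, (0 < p)%N -> (0 < q)%N -> (W p q <= 1)%N.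
Hypothesis W_irr : forall p, W p p = 0%N.
Hypothesis W_deg : forall p, (0 < p <= n)%N -> (\sum_(q < n.+1) W p q = d)%N.
Hypothesis y0 : y 0 = 0.
Hypothesis y_mono : forall k, (k < n)%N -> y k <= y k.+1.
Hypothesis y_eig : forall p, (0 < p <= n)%N ->
  \sum_(q < n.+1) (W p q)%:R * (y p - y q) = mu * y p.
Hypothesis h_gt0 : (0 < h)%N.
Hypothesis n_gt0 : (0 < n)%N.
Hypothesis mu_ge0 : 0 <= mu.
Hypothesis cut_size_gt0 : forall k, (k < n)%N -> (0 < cut_size n W k)%N.
Hypothesis y_neq0 : 0 < \sum_(0 <= k < n) y k.+1 ^+ 2.

(** The coefficient [(d - 2) / 2] of [S 0 ^+ 2] in [level_bound] equals the weight [h - 1 / 2] in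
    [wirtinger], so the two combine to [nu * (d - 1) <= mu * (1 + C * mu + C * nu)], where [nu] is
    [t ^+ 2] up to [t ^+ 4]. *)
Lemma gap_lower_bound (t := pi / 2 / (n + h)%:R : R) :
  (d%:R - 1) * t ^+ 2
    - (d%:R - 1) * (1 + 6 * (d%:R + 1) ^+ 4 * d%:R) * t ^+ 4 <= mu.
Proof.
have hp := h_gt0; have np := n_gt0; have m0 := mu_ge0.
have d3 : (3 <= d)%N by rewrite /d; lia.
have d4 : d != 4%N by apply/eqP; rewrite /d; lia.
have nh0 : 1 <= (n + h)%:R :> R by rewrite ler1n; lia.
have t0 : 0 <= t by rewrite !divr_ge0 // pi_ge0.
have t2 : t <= 2.
  rewrite /t ler_pdivrMr; last lra.
  by have := pihalf_lt2 R; lra.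
have := level_bound W_sym W_le1 W_irr W_deg y0 y_mono y_eig d3 d4 m0 cut_size_gt0.
have := @wirtinger R n h np (tail_sum n y) (tail_sum_end n y).
have -> : \sum_(0 <= k < n) (tail_sum n y k - tail_sum n y k.+1) ^+ 2 =
    \sum_(0 <= k < n) y k.+1 ^+ 2.
  by apply: eq_big_nat => k /andP[_ kn]; rewrite tail_sumS // addrK.
have /andP[] := @wirtinger_rate_bounds R t ltac:(lra).
have Dh : d%:R = 2 * h%:R + 1 :> R by rewrite /d -natr1 -mul2n natrM.
have h1 : 1 <= h%:R :> R by rewrite ler1n.
rewrite Dh -/t; set C := 6 * _.
have C0 : 0 <= C by rewrite mulr_ge0 // exprn_ge0; lra.
have CD0 : 0 <= C * (2 * h%:R + 1) by apply: mulr_ge0 => //; lra.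
have M0 := y_neq0.
move: (\sum_(0 <= k < n) y k.+1 ^+ 2) M0 => M M0.
have Q0 : 0 <= \sum_(0 <= k < n) tail_sum n y k ^+ 2 by apply: sumr_ge0 => k _; exact: sqr_ge0.
move: (\sum_(0 <= k < n) tail_sum n y k ^+ 2) Q0 => Q Q0.
have P0 := sqr_ge0 (tail_sum n y 0).
move: (tail_sum n y 0 ^+ 2) P0 => P P0.
move: (2 - 2 * cos t) => nu nu1 nu2 Hw Hl.
(* Either the claim is immediate, or [mu] is of order [t ^+ 2], as the error terms below require. *)
have [big|small] := leP ((2 * h%:R + 1 - 1) * t ^+ 2) mu.
  apply: le_trans big; rewrite gerBl mulr_ge0 ?exprn_ge0 //.
  by apply: mulr_ge0 => //; lra.
(* If [nu <= 0] then [t ^+ 2 <= t ^+ 4], and the left-hand side of the claim is not positive. *)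
have [nu_neg|nu0] := leP nu 0.
  apply: le_trans m0; rewrite subr_le0.
  apply: (@le_trans _ _ ((2 * h%:R + 1 - 1) * 1 * t ^+ 4)).
    by rewrite mulr1; apply: ler_wpM2l; lra.
  apply: ler_wpM2r; first by rewrite exprn_ge0.
  by apply: ler_wpM2l; [lra | rewrite lerDl].
have key : nu * (2 * h%:R) <= mu * (1 + C * mu + C * nu).
  rewrite -(ler_pM2r M0).
  have Hw' := ler_wpM2l (mulr_ge0 m0 (_ : 0 <= 1 + C * mu)) Hw.
  have {}Hw' := Hw' ltac:(by rewrite addr_ge0 ?mulr_ge0).
  have Hl' := ler_wpM2l (ltW nu0) Hl.
  have E0 : 0 <= mu * (C * mu) * nu * ((h%:R - 1 / 2) * P).
    by rewrite mulr_ge0 ?mulr_ge0 // ?ltW //; lra.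
  lra.
have a1 : mu * (C * mu) <= (2 * h%:R * t ^+ 2) * (C * (2 * h%:R * t ^+ 2)).
  have := sqr_ge0 t => tt; apply: ler_pM; rewrite ?mulr_ge0 //; try lra.
  by apply: ler_wpM2l; lra.
have a2 : mu * (C * nu) <= (2 * h%:R * t ^+ 2) * (C * t ^+ 2).
  have := sqr_ge0 t => tt; apply: ler_pM; rewrite ?mulr_ge0 //; try lra.
  by apply: ler_wpM2l; lra.
have a3 : (2 * h%:R) * (t ^+ 2 - t ^+ 4) <= (2 * h%:R) * nu by apply: ler_wpM2l; lra.
lra.
Qed.

End GapLowerBound.

(** * The largest eigenvalue as a Rayleigh quotient *)

Section Rayleigh.
Variables (R : realType) (n : nat) (e : rel 'I_n).
Hypothesis e_sym : symmetric e.
Hypothesis n_gt0 : (0 < n)%N.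

Definition adj_form (u v : 'I_n -> R) : R :=
  \sum_i \sum_j (e i j)%:R * (u i * v j).

Definition sqr_norm (v : 'I_n -> R) : R := \sum_i v i ^+ 2.

Lemma adj_formC u v : adj_form u v = adj_form v u.
Proof.
rewrite /adj_form exchange_big; apply: eq_bigr => i _; apply: eq_bigr => j _.
by rewrite e_sym [u j * _]mulrC.
Qed.

Lemma continuous_sum_ord (T : topologicalType) (m : nat) (F : 'I_m -> T -> R) :
  (forall i, continuous (F i)) -> continuous (fun v => \sum_i F i v).
Proof. by move=> cF; apply: continuous_big => //; exact: add_continuous. Qed.

(** The form attains a maximum on the compact unit sphere; homogeneity extends the bound to all
    vectors. *)
Lemma rayleigh_max_ex : exists x : 'I_n -> R, sqr_norm x = 1 /\
  forall w, adj_form w w <= adj_form x x * sqr_norm w.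
Proof.
pose f (v : 'rV[R]_n) := adj_form (v ord0) (v ord0).
pose g (v : 'rV[R]_n) := sqr_norm (v ord0).
have cont_coord i : continuous (fun v : 'rV[R]_n => v ord0 i : R) by exact: coord_continuous.
have cg : continuous g.
  apply: continuous_sum_ord => i v.
  exact: continuousM (cont_coord i v) (cont_coord i v).
have cf : continuous f.
  apply: continuous_sum_ord => i; apply: continuous_sum_ord => j v.
  have h1 : {for v, continuous (fun=> (e i j)%:R : R)} by exact: cst_continuous.
  have h2 : {for v, continuous (fun v : 'rV[R]_n => v ord0 i * v ord0 j : R)}.
    exact: continuousM (cont_coord i v) (cont_coord j v).
  exact: continuousM h1 h2.
pose K := [set v | g v = 1].
have cK : compact K.
  apply: bounded_closed_compact.
    exists 1; split; first exact: num_real.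
    move=> M M1 v Kv; apply: le_trans (ltW M1).
    rewrite /Num.Def.normr /= mx_normrE; apply/bigmax_leP; split=> // -[i j] _ /=.
    rewrite -ler_sqr ?nnegrE // expr1n real_normK ?num_real // ord1 -Kv /g /sqr_norm.
    by rewrite (bigD1 j) //= lerDl sumr_ge0 // => k _; exact: sqr_ge0.
  by apply: (@closed_comp _ _ g [set 1]) => // v _; exact: cg.
have K0 : K !=set0.
  exists (\row_i (i == Ordinal n_gt0)%:R); rewrite /K /= /g /sqr_norm.
  rewrite (bigD1 (Ordinal n_gt0)) //= mxE eqxx expr1n big1 ?addr0 // => i /negPf ni.
  by rewrite mxE ni expr0n.
have [c /set_mem cK1 cmax] := compact_EVT_max K0 cK (continuous_subspaceT cf).
exists (c ord0); split=> // w.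
have w0 : 0 <= sqr_norm w by apply: sumr_ge0 => i _; exact: sqr_ge0.
have [wE|wN] := eqVneq (sqr_norm w) 0.
  have wi i : w i = 0.
    move/eqP: wE; rewrite psumr_eq0 => [|j _]; last exact: sqr_ge0.
    by move=> /allP /(_ i (mem_index_enum i)); rewrite sqrf_eq0 => /eqP.
  rewrite wE mulr0 /adj_form big1 // => i _; rewrite big1 // => j _.
  by rewrite wi mul0r mulr0.
pose s := Num.sqrt (sqr_norm w).
have ss : s ^+ 2 = sqr_norm w by rewrite sqr_sqrtr.
have s0 : s != 0 by apply: contra_neq wN => s0; rewrite -ss s0 expr0n.
have := cmax (\row_i (w i / s)); rewrite inE /K /= /g /f.
have -> : sqr_norm ((\row_i (w i / s)) ord0) = 1.
  rewrite /sqr_norm; under eq_bigr do rewrite mxE expr_div_n.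
  by rewrite -mulr_suml -/(sqr_norm w) -ss divff // expf_neq0.
move=> /(_ erefl).
have -> : adj_form ((\row_i (w i / s)) ord0) ((\row_i (w i / s)) ord0) = adj_form w w / s ^+ 2.
  rewrite /adj_form mulr_suml; apply: eq_bigr => i _; rewrite mulr_suml; apply: eq_bigr => j _.
  by rewrite !mxE expr2 invfM; lra.
by rewrite ler_pdivrMr ?ss // lt_def wN.
Qed.

(** Moving [x] along its residual [r] by [s] gives [2 * s * sqr_norm r <= s ^+ 2 * B] for every [s];
    the choice [s = sqr_norm r / (B + 1)] forces [r = 0]. *)
Lemma rayleigh_max_eigen (x : 'I_n -> R) : sqr_norm x = 1 ->
  (forall w, adj_form w w <= adj_form x x * sqr_norm w) ->
  forall i, \sum_j (e i j)%:R * x j = adj_form x x * x i.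
Proof.
set l := adj_form x x => x1 xmax.
pose r i := \sum_j (e i j)%:R * x j - l * x i.
suff r0 : sqr_norm r = 0.
  move=> i; apply/eqP; rewrite -subr_eq0 -/(r i) -sqrf_eq0.
  move/eqP: r0; rewrite psumr_eq0 => [|j _]; last exact: sqr_ge0.
  by move=> /allP /(_ i (mem_index_enum i)).
have rr0 : 0 <= sqr_norm r by apply: sumr_ge0 => i _; exact: sqr_ge0.
have [B BE B0] : exists2 B, B = l * sqr_norm r - adj_form r r & 0 <= B.
  by exists (l * sqr_norm r - adj_form r r); rewrite ?subr_ge0.
have key s : 2 * s * sqr_norm r <= s ^+ 2 * B.
  have := xmax (fun i => x i + s * r i).
  have -> : adj_form (fun i => x i + s * r i) (fun i => x i + s * r i) =
      l + 2 * s * adj_form r x + s ^+ 2 * adj_form r r.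
    have -> : 2 * s * adj_form r x = s * adj_form r x + s * adj_form x r.
      by rewrite [adj_form x r]adj_formC; lra.
    rewrite /l /adj_form !mulr_sumr -!big_split /=; apply: eq_bigr => i _.
    rewrite !mulr_sumr -!big_split /=; apply: eq_bigr => j _.
    move: ((e i j)%:R) (x i) (x j) (r i) (r j) => a b c p q; lra.
  have -> : sqr_norm (fun i => x i + s * r i) =
      1 + 2 * s * \sum_i r i * x i + s ^+ 2 * sqr_norm r.
    rewrite -[X in _ = X + _ + _]x1 /sqr_norm !mulr_sumr -!big_split /=; apply: eq_bigr => i _; lra.
  have : adj_form r x - l * \sum_i r i * x i = sqr_norm r.
    rewrite /adj_form /sqr_norm mulr_sumr -sumrB; apply: eq_bigr => i _.
    rewrite [RHS]expr2 [X in _ = _ * X]/r mulrBr mulr_sumr; congr (_ - _).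
      by apply: eq_bigr => j _; rewrite mulrCA.
    by rewrite mulrCA.
  by move=> E H; rewrite BE; have /= := congr1 (fun z => 2 * s * z) E; lra.
have := key (sqr_norm r / (B + 1)).
move: (sqr_norm r) rr0 => q q0.
set i := (B + 1)^-1.
have iB : i * (B + 1) = 1 by rewrite mulVf //; lra.
have i0 : 0 < i by rewrite invr_gt0; lra.
move=> k.
have : q ^+ 2 * i <= 0.
  have : (q * i) ^+ 2 * B = q ^+ 2 * i * (i * (B + 1)) - q ^+ 2 * i ^+ 2 by lra.
  by rewrite iB; have := mulr_ge0 (sqr_ge0 q) (sqr_ge0 i); lra.
rewrite pmulr_lle0 // => qq; apply/eqP; rewrite -sqrf_eq0 eq_le qq sqr_ge0 //.
Qed.

(** Taking absolute values does not lower the form, so a maximizer can be chosen nonnegative. Every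
    eigenvalue is the quotient of its eigenvector, so the maximum is the greatest eigenvalue and
    [maximum] does not fall back on its default. *)
Lemma lambda1P : exists x : 'I_n -> R, [/\ forall i, 0 <= x i, sqr_norm x = 1,
  forall i, \sum_j (e i j)%:R * x j = lambda1 R e * x i &
  forall w, adj_form w w <= lambda1 R e * sqr_norm w].
Proof.
have [x [x1 xmax]] := rayleigh_max_ex.
pose z i := `|x i|.
have z1 : sqr_norm z = 1.
  by rewrite -x1; apply: eq_bigr => i _; rewrite real_normK ?num_real.
have zx : adj_form z z = adj_form x x.
  apply/eqP; rewrite eq_le; apply/andP; split.
    by have := xmax z; rewrite z1 mulr1.
  apply: ler_sum => i _; apply: ler_sum => j _.
  by apply: ler_wpM2l => //; rewrite -normrM ler_norm.
rewrite -zx in xmax.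
have zeig := rayleigh_max_eigen z1 xmax.
suff lE : lambda1 R e = adj_form z z.
  by exists z; rewrite lE; split=> // i; exact: normr_ge0.
rewrite /lambda1 /maximum; apply: xget_subset1; last first.
  move=> a b [aA au] [bA bu]; apply/eqP; rewrite eq_le.
  by apply/andP; split; [apply: (bu a aA) | apply: (au b bA)].
split=> /=.
  apply/eigenvalueP; exists (\row_i z i).
    apply/rowP => j; rewrite !mxE -zeig; apply: eq_bigr => i _.
    by rewrite !mxE e_sym mulrC.
  apply/eqP => /rowP z0; move: z1; rewrite /sqr_norm big1 => [/esym/eqP|i _].
    by rewrite oner_eq0.
  by have := z0 i; rewrite !mxE => ->; rewrite expr0n.
move=> a /eigenvalueP [v vA v0].
have vv : sqr_norm (v ord0) > 0.
  rewrite lt_def sumr_ge0 ?andbT => [|i _]; last exact: sqr_ge0.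
  apply: contra v0; rewrite psumr_eq0 => [/allP vi|i _]; last exact: sqr_ge0.
  apply/eqP/rowP => i; rewrite mxE; apply/eqP.
  by have := vi i (mem_index_enum i); rewrite sqrf_eq0.
have := xmax (v ord0).
have -> : adj_form (v ord0) (v ord0) = a * sqr_norm (v ord0).
  rewrite /adj_form exchange_big /= mulr_sumr; apply: eq_bigr => j _.
  have /rowP/(_ j) := vA; rewrite !mxE => E.
  rewrite expr2 mulrA -E mulr_suml; apply: eq_bigr => i _.
  by rewrite mxE; lra.
by rewrite ler_pM2r.
Qed.

End Rayleigh.

(** * Upper bound on the largest eigenvalue *)

Lemma degreeE (T : finType) (e : rel T) x : degree e x = (\sum_y e x y)%N.
Proof. by rewrite /degree cardsE -sum1_card big_mkcond. Qed.

Section Levelling.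
Variables (R : realType) (n h : nat) (e : rel 'I_n).
Let d := h.*2.+1.
Hypothesis h_gt0 : (0 < h)%N.
Hypothesis e_fam : @graph_family n d e.

Let e_sym : symmetric e. Proof. by case: e_fam => -[]. Qed.
Let e_irr : irreflexive e. Proof. by case: e_fam => -[]. Qed.

Let n_gt0 : (0 < n)%N.
Proof.
rewrite lt0n; apply/eqP => n0; case: e_fam => _ _ nreg _; apply: nreg.
by exists 0%N => x; have := ltn_ord x; lia.
Qed.

Let deg_le x : (degree e x <= d)%N.
Proof. by case: e_fam => _ _ _ <-; exact: leq_bigmax. Qed.

Variable x : 'I_n -> R.
Hypothesis x_ge0 : forall i, 0 <= x i.
Hypothesis x_norm : sqr_norm x = 1.
Hypothesis x_eig : forall i, \sum_j (e i j)%:R * x j = lambda1 R e * x i.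

Let levels := sort (fun i j => x i <= x j) (enum 'I_n).

Let size_levels : size levels = n. Proof. by rewrite size_sort size_enum_ord. Qed.

Let uniq_levels : uniq levels. Proof. by rewrite sort_uniq enum_uniq. Qed.

Let mem_levels i : i \in levels. Proof. by rewrite mem_sort mem_enum. Qed.

Let v k := nth (Ordinal n_gt0) levels k.

Let sum_levels (V : nmodType) (F : 'I_n -> V) : \sum_(q < n) F (v q) = \sum_j F j.
Proof.
rewrite -(big_mkord xpredT (fun q => F (v q))) -{1}size_levels -(big_nth _ xpredT).
by rewrite (perm_big _ (permEl (perm_sort _ _))) big_enum.
Qed.

(* The index 0 stands for the ground: a vertex of degree [d - k] sends [k] edges to it. *)
Let W (p q : nat) : nat :=
  match p, q with
  | 0, 0 => 0
  | 0, q'.+1 => d - degree e (v q')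
  | p'.+1, 0 => d - degree e (v p')
  | p'.+1, q'.+1 => e (v p') (v q')
  end.

Let y (p : nat) : R := if p is p'.+1 then x (v p') else 0.

Let W_deg p : (0 < p <= n)%N -> (\sum_(q < n.+1) W p q = d)%N.
Proof.
case: p => // p _; rewrite big_ord_recl /=.
have -> : (\sum_(i < n) e (v p) (v i) = degree e (v p))%N.
  by rewrite degreeE (sum_levels (fun j => nat_of_bool (e (v p) j))).
by rewrite subnK.
Qed.

Let y_mono k : (k < n)%N -> y k <= y k.+1.
Proof.
case: k => [|k] kn /=; first exact: x_ge0.
have tr : transitive (fun i j => x i <= x j) by move=> b a c; exact: le_trans.
have rf : reflexive (fun i j => x i <= x j) by move=> a; exact: lexx.
have tot : total (fun i j => x i <= x j) by move=> a b; exact: le_total.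
apply: (sorted_leq_nth tr rf (Ordinal n_gt0) (sort_sorted tot (enum 'I_n))) => //;
  by rewrite inE -/levels size_levels; lia.
Qed.

Let y_eig p : (0 < p <= n)%N ->
  \sum_(q < n.+1) (W p q)%:R * (y p - y q) = (d%:R - lambda1 R e) * y p.
Proof.
move=> pn; under eq_bigr do rewrite mulrBr.
rewrite sumrB -mulr_suml -natr_sum W_deg // mulrBl; congr (_ - _).
case: p pn => // p _; rewrite big_ord_recl /= mulr0 add0r.
by rewrite (sum_levels (fun j => (e (v p) j)%:R * x j)).
Qed.

Let lambda1_le : lambda1 R e <= d%:R.
Proof.
have -> : lambda1 R e = adj_form e x x.
  rewrite -[LHS]mulr1 -x_norm mulr_sumr /adj_form; apply: eq_bigr => i _.
  rewrite expr2 mulrA -x_eig mulr_suml; apply: eq_bigr => j _; lra.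
have -> : d%:R = d%:R * sqr_norm x by rewrite x_norm mulr1.
apply: (@le_trans _ _ (\sum_i \sum_j (e i j)%:R * x i ^+ 2)).
  rewrite -subr_ge0.
  have -> : \sum_i \sum_j (e i j)%:R * x i ^+ 2 =
      \sum_i \sum_j (e i j)%:R * ((x i ^+ 2 + x j ^+ 2) / 2).
    have E : \sum_i \sum_j (e i j)%:R * x i ^+ 2 = \sum_i \sum_j (e i j)%:R * x j ^+ 2.
      rewrite exchange_big; apply: eq_bigr => i _; apply: eq_bigr => j _.
      by rewrite e_sym.
    have -> : \sum_i \sum_j (e i j)%:R * ((x i ^+ 2 + x j ^+ 2) / 2) =
        (\sum_i \sum_j (e i j)%:R * x i ^+ 2 + \sum_i \sum_j (e i j)%:R * x j ^+ 2) / 2.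
      rewrite -big_split /= mulr_suml; apply: eq_bigr => i _.
      rewrite -big_split /= mulr_suml; apply: eq_bigr => j _; lra.
    by rewrite -E; lra.
  rewrite /adj_form -sumrB; apply: sumr_ge0 => i _; rewrite -sumrB; apply: sumr_ge0 => j _.
  rewrite -mulrBr; apply: mulr_ge0 => //.
  by have := sqr_ge0 (x i - x j); lra.
rewrite /sqr_norm mulr_sumr; apply: ler_sum => i _.
rewrite -mulr_suml; apply: ler_wpM2r; first exact: sqr_ge0.
by rewrite -natr_sum ler_nat -degreeE.
Qed.

Let vK j : v (index j levels) = j. Proof. exact: nth_index. Qed.

Let cut_pos k (p q : nat) : (p <= k < q)%N -> (q <= n)%N -> (0 < W p q)%N ->
  (0 < cut_size n W k)%N.
Proof.
move=> /andP[pk kq] qn Wpq.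
have pn : (p < n.+1)%N by lia.
rewrite /cut_size /cross_both (bigD1 (Ordinal pn)) //= (bigD1 (Ordinal (qn : (q < n.+1)%N))) //=.
by rewrite pk kq /= muln1; lia.
Qed.

(** The cut 0 is crossed by a ground edge, since a nonregular graph has a vertex of degree below
    [d]. If another cut were empty, the vertices below it would be closed under adjacency, against
    connectedness. *)
Let cut_size_gt0 k : (k < n)%N -> (0 < cut_size n W k)%N.
Proof.
move=> kn; case: (e_fam) => _ econ nreg _.
have vin j : (index j levels < n)%N by rewrite -[X in (_ < X)%N]size_levels index_mem.
case: k kn => [|k] kn.
  have [i di] : exists i, degree e i != d.
    apply/existsP; rewrite -negb_forall; apply/negP => /forallP H.
    by apply: nreg; exists d => i; apply/eqP; exact: (H i).
  apply: (@cut_pos 0 0 (index i levels).+1) => //.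
  by rewrite /W vK subn_gt0 ltn_neqAle di deg_le.
pose A := [pred i : 'I_n | (index i levels <= k)%N].
have sc : connect_sym e by apply: sym_connect_sym.
have [cl|] := boolP [forall a, forall b, (a \in A) ==> e a b ==> (b \in A)].
  have clA : fingraph.closed e A.
    apply: intro_closed => // a b eab aA.
    by move/forallP/(_ a)/forallP/(_ b): cl; rewrite aA eab.
  have := closed_connect clA (econ (v 0) (v k.+1)).
  by rewrite !inE !index_uniq ?size_levels // ltnn.
rewrite negb_forall => /existsP[a]; rewrite negb_forall => /existsP[b].
rewrite !negb_imply !inE => /and3P[ak eab bk].
apply: (@cut_pos k.+1 (index a levels).+1 (index b levels).+1).
- by rewrite !ltnS ak ltnNge.
- exact: vin.
by rewrite /W !vK eab.
Qed.

Lemma lambda1_upper_aux (t := pi / 2 / (n + h)%:R : R) :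
  lambda1 R e <= d%:R - (d%:R - 1) * t ^+ 2
    + (d%:R - 1) * (1 + 6 * (d%:R + 1) ^+ 4 * d%:R) * t ^+ 4.
Proof.
have W_sym p q : W p q = W q p by case: p => [|p]; case: q => [|q] //=; rewrite e_sym.
have W_le1 p q : (0 < p)%N -> (0 < q)%N -> (W p q <= 1)%N.
  by case: p => // p; case: q => // q _ _ /=; case: (e _ _).
have W_irr p : W p p = 0%N by case: p => [|p] //=; rewrite e_irr.
have mu0 : 0 <= d%:R - lambda1 R e by rewrite subr_ge0 lambda1_le.
have y1 : 0 < \sum_(0 <= k < n) y k.+1 ^+ 2.
  by rewrite big_mkord /= (sum_levels (fun j => x j ^+ 2)) -/(sqr_norm x) x_norm.
have H := gap_lower_bound W_sym W_le1 W_irr W_deg (erefl : y 0 = 0) y_mono y_eig h_gt0 n_gt0 mu0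
  cut_size_gt0 y1.
cbv zeta in H; rewrite -/t -/d in H.
by move: (lambda1 R e) t H => l s H; lra.
Qed.

End Levelling.

Lemma lambda1_upper (R : realType) (n h : nat) (e : rel 'I_n)
  (t := pi / 2 / (n + h)%:R : R) (d := h.*2.+1) : (0 < h)%N -> graph_family d e ->
  lambda1 R e <= d%:R - (d%:R - 1) * t ^+ 2
    + (d%:R - 1) * (1 + 6 * (d%:R + 1) ^+ 4 * d%:R) * t ^+ 4.
Proof.
move=> h0 fam; have [n0|n0] := posnP n.
  case: (fam) => _ _ nreg _; case: nreg; exists 0%N => x.
  by have := ltn_ord x; rewrite {2}n0.
have e_sym : symmetric e by case: fam => -[].
have [x [x0 x1 xe _]] := lambda1P R e_sym n0.
exact: lambda1_upper_aux h0 fam x x0 x1 xe.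
Qed.

(** * Chains of blocks *)

(** The invariant of the construction: exactly one edge is missing, at the root, where the next
    bridge is attached. *)
Definition rooted_graph (d : nat) (T : finType) (e : rel T) (r : T) : Prop :=
  [/\ simple_graph e, connected_graph e, degree e r = d.-1 &
      forall x, x != r -> degree e x = d].

Lemma sum_indic_range m a b :
  (\sum_(j < m) (a <= j < b)%N = minn b m - a)%N.
Proof.
elim: m => [|m IH]; first by rewrite big_ord0; lia.
by rewrite big_ord_recr /= IH; lia.
Qed.

Lemma connect_from_root (T : finType) (e : rel T) r :
  symmetric e -> (forall x, connect e r x) -> connected_graph e.
Proof.
move=> es er x y; apply: connect_trans (er y).
by rewrite (sym_connect_sym es).
Qed.

(* The circulant graph of degree [2 h] on [2 p + 1] vertices, together with the matching
   [i -- i + p] for [i < p], which misses only the last vertex. *)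
Definition base_rel (h p : nat) : rel 'I_p.*2.+1 := fun i j =>
  let D := ((i - j) + (j - i))%N in
  (i != j) && [|| (D <= h)%N, (p.*2.+1 <= D + h)%N | (D == p) && (minn i j < p)%N].

(** The neighbours above [i] form three disjoint intervals: near ones, ones reached around the
    cycle, and the matching partner. The zeros hold the places of the intervals below [i]. *)
Lemma circulant_indicator (h p i j : nat) : (i < j)%N -> (j < p.*2.+1)%N -> (0 < h < p)%N ->
  ([|| (j - i <= h), (p.*2.+1 <= j - i + h) | (j - i == p) && (minn i j < p)] =
  (i.+1 <= j < i + h.+1) + 0 + (i + p.*2.+1 - h <= j < p.*2.+1) + 0
    + (i + p <= j < i + p + (i < p)) + 0 :> nat)%N.
Proof.
move=> ij jm hp.
have -> : (i.+1 <= j < i + h.+1)%N = (j - i <= h)%N by lia.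
have -> : (i + p.*2.+1 - h <= j < p.*2.+1)%N = (p.*2.+1 <= j - i + h)%N by lia.
have -> : (i + p <= j < i + p + (i < p)%N)%N = ((j - i == p) && (minn i j < p))%N.
  by case: (boolP (i < p)%N) => a; lia.
case: (leqP (j - i)%N h) => a; case: (leqP p.*2.+1 (j - i + h)%N) => b;
  case: (boolP (((j - i)%N == p) && (minn i j < p)%N)) => c //; lia.
Qed.

Lemma base_rooted (h p : nat) : (0 < h < p)%N ->
  rooted_graph h.*2.+1 (base_rel h (p := p)) ord_max.
Proof.
move=> hp.
have bsym : symmetric (base_rel h (p := p)).
  by move=> i j; rewrite /base_rel eq_sym addnC minnC.
have deg (i : 'I_p.*2.+1) : degree (base_rel h (p := p)) i = (h.*2 + (i < p.*2))%N.
  rewrite degreeE; have := ltn_ord i => im.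
  (* Six intervals, three on each side of [i]; the degree is the sum of their lengths. *)
  rewrite (eq_bigr (fun j : 'I_p.*2.+1 => ((i.+1 <= j < i + h.+1) + (i - h <= j < i)
    + (i + p.*2.+1 - h <= j < p.*2.+1) + (0 <= j < i + h.+1 - p.*2.+1)
    + (i + p <= j < i + p + (i < p)) + (i - p <= j < i - p + (p <= i < p.*2)))%N)); last first.
    move=> j _; have := ltn_ord j; rewrite /base_rel -val_eqE /=.
    move: (val i) (val j) im => {}i {}j im jm.
    have [ij|[ji|->]] : (i < j)%N \/ (j < i)%N \/ i = j by lia.
    - have -> : i != j by lia.
      rewrite /= (_ : (i - j = 0)%N) ?add0n; last by lia.
      rewrite (_ : (i - h <= j < i)%N = false); last by lia.
      rewrite (_ : (j < i + h.+1 - p.*2.+1)%N = false); last by lia.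
      rewrite (_ : (i - p <= j < i - p + (p <= i < p.*2)%N)%N = false); last first.
        by case: (boolP (p <= i < p.*2)%N); lia.
      exact: circulant_indicator.
    - have -> : i != j by lia.
      rewrite /= (_ : (j - i = 0)%N) ?addn0; last by lia.
      rewrite (_ : (i.+1 <= j < i + h.+1)%N = false); last by lia.
      rewrite (_ : (i + p.*2.+1 - h <= j < p.*2.+1)%N = false); last by lia.
      rewrite (_ : (i + p <= j < i + p + (i < p)%N)%N = false); last first.
        by case: (boolP (i < p)%N); lia.
      rewrite minnC (circulant_indicator ji im hp).
      rewrite (_ : (i - h <= j < i)%N = (j.+1 <= i < j + h.+1)%N); last by lia.
      rewrite (_ : (j < i + h.+1 - p.*2.+1)%N = (j + p.*2.+1 - h <= i < p.*2.+1)%N); last by lia.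
      rewrite (_ : (i - p <= j < i - p + (p <= i < p.*2)%N)%N =
        (j + p <= i < j + p + (j < p)%N)%N); last first.
        by case: (boolP (p <= i < p.*2)%N); case: (boolP (j < p)%N); lia.
      by rewrite !(add0n, addn0).
    rewrite eqxx /=; have -> : (j - h <= j < j)%N = false by lia.
    have -> : (j.+1 <= j < j + h.+1)%N = false by lia.
    have -> : (j + p.*2.+1 - h <= j < p.*2.+1)%N = false by lia.
    have -> : (j < j + h.+1 - p.*2.+1)%N = false by lia.
    have -> : (j + p <= j < j + p + (j < p)%N)%N = false by lia.
    by have -> : (j - p <= j < j - p + (p <= j < p.*2)%N)%N = false
      by case: (boolP (p <= j < p.*2)%N); lia.
  rewrite !big_split /= (sum_indic_range _ 0) !sum_indic_range.
  move: (val i) im => {}i im.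
  have -> : (minn p.*2.+1 p.*2.+1 - (i + p.*2.+1 - h) = h - i)%N by lia.
  have -> : (minn i p.*2.+1 - (i - h) = minn i h)%N by lia.
  have -> : (minn (i + h.+1) p.*2.+1 - i.+1 = minn h (p.*2 - i))%N by lia.
  have -> : (minn (i + h.+1 - p.*2.+1) p.*2.+1 - 0 = i + h - p.*2)%N by lia.
  have -> : (minn (i + p + (i < p)) p.*2.+1 - (i + p) = (i < p))%N.
    by case: (ltnP i p); lia.
  have -> : (minn (i - p + (p <= i < p.*2)) p.*2.+1 - (i - p) = (p <= i < p.*2))%N.
    by case: (boolP (p <= i < p.*2)%N); lia.
  have -> : ((i < p.*2) = (i < p) + (p <= i < p.*2) :> nat)%N.
    by case: (ltnP i p) => a; case: (ltnP i p.*2) => b //; lia.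
  by case: (leqP i h); case: (leqP (i + h)%N p.*2); lia.
split=> [|||i].
- split=> // i; rewrite /base_rel eqxx //.
- apply: (@connect_from_root _ _ ord0) => // -[i im].
  elim: i im => [|i IH] im; first by rewrite (_ : Ordinal im = ord0) ?connect0 //; exact: val_inj.
  apply: connect_trans (IH (ltnW im)) _; apply: connect1.
  by rewrite /base_rel -val_eqE /=; lia.
- by rewrite deg /= ltnn addn0.
- rewrite deg -val_eqE /= => ip.
  by rewrite ltn_neqAle ip -ltnS ltn_ord addn1.
Qed.

Lemma homo_connect (T T' : finType) (e : rel T) (e' : rel T') (f : T -> T') :
  (forall x y, e x y -> connect e' (f x) (f y)) ->
  forall x y, connect e x y -> connect e' (f x) (f y).
Proof.
move=> ef x y /connectP[s es ->]; elim: s x es => [|z s IH] x /=; first by rewrite connect0.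
by move=> /andP[exz es]; apply: connect_trans (ef _ _ exz) (IH _ es).
Qed.

(** The Dirichlet form; the factor [1 / 2] compensates for counting each edge in both orders. *)
Definition energy (R : realType) (T : finType) (e : rel T) (w : T -> R) : R :=
  \sum_x \sum_y (e x y)%:R * (w x - w y) ^+ 2 / 2.

Definition mass (R : realType) (T : finType) (w : T -> R) : R := \sum_x w x ^+ 2.

(** * Attaching a block at the root *)

Section AttachBlock.
Variables (T : finType) (e : rel T) (r : T) (k : nat).

(* [inl false] and [inl true] are the two nonadjacent vertices of the new block, the first
   one joined to [r], the second one being the new root. *)
Definition block_rel : rel (T + (bool + 'I_k)) := fun x y =>
  match x, y with
  | inl u, inl v => e u v
  | inl u, inr (inl b) => (u == r) && ~~ b
  | inr (inl b), inl v => (v == r) && ~~ b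
  | inr (inl _), inr (inr _) => true
  | inr (inr _), inr (inl _) => true
  | inr (inr i), inr (inr j) => i != j
  | _, _ => false
  end.

Definition block_root : T + (bool + 'I_k) := inr (inl true).

Lemma sum_ord1 m : (\sum_(i < m) 1)%N = m.
Proof. by rewrite big_const_ord iter_addn_0 mul1n. Qed.

Lemma sum_eq_bool (x : T) : (\sum_y (y == x))%N = 1%N.
Proof. by rewrite (bigD1 x) //= eqxx big1 // => i /negPf->. Qed.

(** The bridge supplies the edge missing at [r] and at the first nonadjacent vertex of the block;
    the second one still lacks an edge and becomes the root. *)
Lemma block_rooted : (0 < k)%N -> rooted_graph k.+1 e r -> rooted_graph k.+1 block_rel block_root.
Proof.
move=> k0 [[es ei] ec er ed].
have bsym : symmetric block_rel.
  move=> [u|[b|i]] [v|[b'|j]] //=.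
  by rewrite eq_sym.
pose i0 := Ordinal k0.
split=> [|||x].
- by split=> // -[u|[b|i]] //=; rewrite ?ei ?eqxx.
- apply: (@connect_from_root _ _ block_root) => // x.
  have mid : connect block_rel block_root (inr (inr i0)) by apply: connect1.
  have c : connect block_rel block_root (inr (inl false)).
    by apply: connect_trans mid _; apply: connect1.
  case: x => [u|[[]|i]].
  + apply: connect_trans c _; apply: (@connect_trans _ _ (inl r)).
      by apply: connect1; rewrite /= eqxx.
    apply: (homo_connect (e := e)) => [x y exy|]; first exact: connect1.
    exact: ec.
  + exact: connect0.
  + exact: c.
  + exact: connect1.
- by rewrite degreeE !big_sumType /= big_bool big1 /= ?sum_ord1 // => u _; rewrite andbF.
- rewrite degreeE !big_sumType big_bool; case: x => [u|[[]|i]] //= _.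
  + have [->|ur] := eqVneq u r.
      by rewrite -degreeE er big1 //=; lia.
    by rewrite -degreeE ed // big1 //=; lia.
  + have -> : (\sum_(v : T) (v == r) && true)%N = 1%N.
      by under eq_bigr do rewrite andbT; exact: sum_eq_bool.
    by rewrite sum_ord1; lia.
  + have -> : (\sum_(j < k) (i != j) = k.-1)%N.
      have E : (\sum_(j < k) ((i != j) + (j == i)) = k)%N.
        by rewrite -[RHS]sum_ord1; apply: eq_bigr => j _; rewrite eq_sym; case: eqP.
      have E1 : (\sum_(j < k) (j == i) = 1)%N.
        by rewrite (bigD1 i) //= eqxx big1 // => j /negPf->.
      by move: E; rewrite big_split /= E1 addn1 => /(congr1 predn).
    by rewrite big1 //; lia.
Qed.

Variable R : realType.
Variables (w : T -> R) (c b a : R).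

Definition block_fun (x : T + (bool + 'I_k)) : R :=
  match x with
  | inl u => w u
  | inr (inl false) => c
  | inr (inl true) => a
  | inr (inr _) => b
  end.

Lemma mass_block : mass block_fun = mass w + (c ^+ 2 + a ^+ 2 + k%:R * b ^+ 2).
Proof.
rewrite /mass !big_sumType big_bool /= sumr_const card_ord -[_ *+ k]mulr_natl.
by rewrite [a ^+ 2 + _]addrC.
Qed.

Lemma energy_block : energy block_rel block_fun =
  energy e w + ((w r - c) ^+ 2 + k%:R * ((c - b) ^+ 2 + (b - a) ^+ 2)).
Proof.
have sum_r (F : T -> R) : \sum_u (u == r)%:R * F u = F r.
  rewrite (bigD1 r) //= eqxx mul1r big1 ?addr0 // => u /negPf->.
  by rewrite mul0r.
pose E x := \sum_y (block_rel x y)%:R * (block_fun x - block_fun y) ^+ 2 / 2.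
have Eu u : E (inl u) = \sum_v (e u v)%:R * (w u - w v) ^+ 2 / 2
    + (u == r)%:R * ((w u - c) ^+ 2 / 2).
  rewrite /E !big_sumType big_bool /= [X in _ + (_ + X)]big1 => [|i _]; last by rewrite !mul0r.
  rewrite andbF andbT /= !mul0r; lra.
have Ec : E (inr (inl false)) = (w r - c) ^+ 2 / 2 + k%:R * ((c - b) ^+ 2 / 2).
  rewrite /E !big_sumType big_bool /=.
  under eq_bigr do rewrite andbT -mulrA.
  by rewrite sum_r sumr_const card_ord -[_ *+ k]mulr_natl; lra.
have Ea : E (inr (inl true)) = k%:R * ((b - a) ^+ 2 / 2).
  rewrite /E !big_sumType big_bool /= big1 => [|u _]; last by rewrite andbF !mul0r.
  by rewrite sumr_const card_ord -[_ *+ k]mulr_natl; lra.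
have Eb i : E (inr (inr i)) = ((c - b) ^+ 2 + (b - a) ^+ 2) / 2.
  rewrite /E !big_sumType big_bool /= big1 => [|u _]; last by rewrite !mul0r.
  rewrite [X in _ + (_ + X)]big1 => [|j _]; first by lra.
  by rewrite subrr expr0n /= mulr0 mul0r.
rewrite (_ : energy block_rel block_fun = \sum_x E x) // !big_sumType big_bool Ec Ea.
under eq_bigr do rewrite Eu.
under [X in _ + (_ + X) = _]eq_bigr do rewrite Eb.
rewrite big_split /= sum_r sumr_const card_ord -[_ *+ k]mulr_natl /energy; lra.
Qed.

End AttachBlock.

(** * The pendant vertex for even order *)

Section Pendant.
Variables (T : finType) (e : rel T) (r : T).

Definition pendant_rel : rel (T + 'I_1) := fun x y =>
  match x, y with
  | inl u, inl v => e u v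
  | inl u, inr _ => u == r
  | inr _, inl v => v == r
  | inr _, inr _ => false
  end.

Lemma pendant_simple : simple_graph e -> simple_graph pendant_rel.
Proof. by move=> [es ei]; split=> [[u|i] [v|j]|[u|i]] //=. Qed.

Lemma pendant_connected : simple_graph e -> connected_graph e -> connected_graph pendant_rel.
Proof.
move=> se ec; have [ps _] := pendant_simple se.
apply: (@connect_from_root _ _ (inl r)) => // -[u|i].
  by apply: (homo_connect (e := e)) (ec r u) => x y exy; apply: connect1.
by apply: connect1; rewrite /= eqxx.
Qed.

Lemma degree_pendant u : degree pendant_rel (inl u) = (degree e u + (u == r))%N.
Proof. by rewrite !degreeE big_sumType big_ord1. Qed.

Lemma degree_pendant_leaf i : degree pendant_rel (inr i) = 1%N.
Proof. by rewrite !degreeE big_sumType /= sum_eq_bool big_ord1. Qed.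

Variables (R : realType) (w : T -> R) (p : R).

Definition pendant_fun (x : T + 'I_1) : R := if x is inl u then w u else p.

Lemma mass_pendant : mass pendant_fun = mass w + p ^+ 2.
Proof. by rewrite /mass big_sumType big_ord1. Qed.

Lemma energy_pendant : energy pendant_rel pendant_fun = energy e w + (w r - p) ^+ 2.
Proof.
have sum_r (F : T -> R) : \sum_u (u == r)%:R * F u = F r.
  rewrite (bigD1 r) //= eqxx mul1r big1 ?addr0 // => u /negPf->.
  by rewrite mul0r.
rewrite /energy big_sumType big_ord1 /=.
under eq_bigr do rewrite big_sumType big_ord1 /= -[X in _ + X]mulrA.
rewrite big_split /= sum_r big_sumType big_ord1 /= !mul0r addr0.
under [X in _ + X = _]eq_bigr do rewrite -mulrA.
by rewrite sum_r; lra.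
Qed.

End Pendant.

Lemma adj_form_energy (R : realType) (T : finType) (e : rel T) (w : T -> R) :
  symmetric e ->
  \sum_x \sum_y (e x y)%:R * (w x * w y) =
  \sum_x (degree e x)%:R * w x ^+ 2 - energy e w.
Proof.
move=> es.
have E : \sum_x \sum_y (e x y)%:R * w y ^+ 2 = \sum_x (degree e x)%:R * w x ^+ 2.
  rewrite exchange_big; apply: eq_bigr => x _; rewrite degreeE natr_sum mulr_suml.
  by apply: eq_bigr => y _; rewrite es.
have E' : \sum_x \sum_y (e x y)%:R * w x ^+ 2 = \sum_x (degree e x)%:R * w x ^+ 2.
  by apply: eq_bigr => x _; rewrite degreeE natr_sum mulr_suml.
have -> : \sum_x \sum_y (e x y)%:R * (w x * w y) =
    (\sum_x \sum_y (e x y)%:R * w x ^+ 2 + \sum_x \sum_y (e x y)%:R * w y ^+ 2) / 2 - energy e w.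
  rewrite /energy -big_split /= mulr_suml -sumrB; apply: eq_bigr => x _.
  rewrite -big_split /= mulr_suml -sumrB; apply: eq_bigr => y _.
  lra.
by rewrite E E'; lra.
Qed.

(** Transports the graph to ordinals and tests the Rayleigh quotient with [w]; the last sum is the
    energy of the edges to the ground. *)
Lemma graph_on_ordinals (R : realType) (d : nat) (T : finType) (e : rel T) (w : T -> R) (r : T) :
  simple_graph e -> connected_graph e -> (forall x, degree e x <= d)%N ->
  (exists x, degree e x = d) -> (exists x, degree e x <> d) ->
  exists2 e' : rel 'I_#|T|, graph_family d e' &
    (d%:R - lambda1 R e') * mass w <=
    energy e w + \sum_x (d%:R - (degree e x)%:R) * w x ^+ 2.
Proof.
move=> [es ei] ec dle [x1 dx1] [x2 dx2].
pose e' : rel 'I_#|T| := fun i j => e (enum_val i) (enum_val j).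
have e's : symmetric e' by move=> i j; exact: es.
have sumT (V : nmodType) (F : T -> V) : \sum_(i < #|T|) F (enum_val i) = \sum_x F x.
  by rewrite (big_enum_val (A := T)).
have deg' i : degree e' i = degree e (enum_val i).
  by rewrite !degreeE -(sumT nat (fun y => nat_of_bool (e (enum_val i) y))).
have T0 : (0 < #|T|)%N by apply/card_gt0P; exists r.
exists e'.
  split=> //.
  - by split=> // i; rewrite /e' ei.
  - move=> i j; rewrite -[i]enum_valK -[j]enum_valK.
    apply: (homo_connect (e := e)) => // x y exy; apply: connect1.
    by rewrite /e' !enum_rankK.
  - move=> [k H]; apply: dx2.
    by rewrite -dx1 -[x1]enum_rankK -[x2]enum_rankK -!deg' !H.
  apply/eqP; rewrite eqn_leq; apply/andP; split.
    by apply/bigmax_leqP => i _; rewrite deg'.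
  by rewrite -dx1 -[x1]enum_rankK -deg'; exact: leq_bigmax.
have [_ [_ _ _ /(_ (fun i => w (enum_val i)))]] := lambda1P R e's T0.
have -> : sqr_norm (fun i : 'I_#|T| => w (enum_val i)) = mass w.
  by rewrite /sqr_norm (sumT _ (fun x => w x ^+ 2)).
have -> : adj_form e' (fun i => w (enum_val i)) (fun i => w (enum_val i)) =
    \sum_x \sum_y (e x y)%:R * (w x * w y).
  rewrite /adj_form -[RHS]sumT; apply: eq_bigr => i _.
  by rewrite -[RHS]sumT.
rewrite adj_form_energy // => H.
have -> : \sum_x (d%:R - (degree e x)%:R) * w x ^+ 2 =
    d%:R * mass w - \sum_x (degree e x)%:R * w x ^+ 2.
  by rewrite /mass mulr_sumr -sumrB; apply: eq_bigr => x _; rewrite mulrBl.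
by lra.
Qed.

(** * Cosine estimates along the chain *)

Section ChainStep.
Variable R : realType.
Implicit Types (p q t Z H u : R).

Lemma cos_diff_sqr p q :
  (cos (p - q) - cos (p + q)) ^+ 2 <= 2 * q ^+ 2 * (1 - cos (2 * p)).
Proof.
have := ler_wpM2l (sqr_ge0 (2 * sin p)) (sin_sqr_le q).
by rewrite cosB cosD cos_double; lra.
Qed.

Lemma cos_sqr_double p : cos p ^+ 2 = (1 + cos (2 * p)) / 2.
Proof. by rewrite cos_double cos2sin2; lra. Qed.

Lemma mul_cos_ge u K c : `|K| <= c -> - c <= cos u * K.
Proof.
move=> Kc; rewrite lerNl; apply: le_trans Kc; apply: le_trans (ler_norm _) _.
by rewrite normrN normrM ler_piMl // cos_max.
Qed.

Lemma sin_over_bounds t H : 0 < t -> 0 <= H ->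
  2 * (H + 1) - 4 * (H + 1) ^+ 3 * t ^+ 2 <= sin (2 * (H + 1) * t) / t <= 2 * (H + 1).
Proof.
move=> t0 H0; have g0 : 0 <= 2 * (H + 1) * t by rewrite mulr_ge0 ?mulr_ge0 //; lra.
have s1 := sin_le_id g0; have s2 := sin_ge g0.
by rewrite ler_pdivlMr // ler_pdivrMr //; apply/andP; split; lra.
Qed.

Section Step.
Variables (t Z H : R).
Hypothesis t_gt0 : 0 < t.
Hypothesis H_ge1 : 1 <= H.

(** Positions along the chain are electrical resistances scaled by [2 * H]: a bridge runs from
    [Z - H] to [Z + H], and each layer of [2 * H] parallel edges has length 1. The doubled angle is
    [u] at the centre of the block, and [u - g], [u + g] at the midpoints of the adjacent
    bridges. *)
Let u := 2 * t * (Z + H + 1).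
Let g := 2 * (H + 1) * t.
Let c := cos (t * (Z + H)).
Let b := cos (t * (Z + H + 1)).
Let a := cos (t * (Z + H + 2)).
Let Z' := Z + 2 * H + 2.

Let mass_inc : c ^+ 2 + a ^+ 2 + 2 * H * b ^+ 2 = 1 + cos u * cos (2 * t) + H * (1 + cos u).
Proof.
rewrite !cos_sqr_double.
have -> : 2 * (t * (Z + H)) = u - 2 * t by rewrite /u; lra.
have -> : 2 * (t * (Z + H + 2)) = u + 2 * t by rewrite /u; lra.
have -> : 2 * (t * (Z + H + 1)) = u by rewrite /u; lra.
by rewrite cosB cosD; lra.
Qed.

Let sin_inc : (sin (2 * t * Z') - sin (2 * t * Z)) = 2 * (cos u * sin g).
Proof.
have -> : 2 * t * Z' = u + g by rewrite /u /g /Z'; lra.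
have -> : 2 * t * Z = u - g by rewrite /u /g; lra.
by rewrite sinB sinD; lra.
Qed.

Let cos_bounds : [/\ 1 - t ^+ 2 / 2 <= cos t, 1 - 2 * t ^+ 2 <= cos (2 * t),
  1 - 2 * (H + 1) ^+ 2 * t ^+ 2 <= cos g &
  2 * (H + 1) - 4 * (H + 1) ^+ 3 * t ^+ 2 <= sin g / t <= 2 * (H + 1)].
Proof.
have t0 := t_gt0; have H1 := H_ge1.
split; first exact: cos_ge.
- by have := cos_ge (2 * t); lra.
- by have := cos_ge g; rewrite /g; lra.
- by apply: sin_over_bounds => //; lra.
Qed.

(** Energy yields terms [1 - cos] and mass terms [1 + cos] of doubled angles. The increments of
    [cos] and [sin] correct the difference and telescope along the chain; what is left is [cos u]
    times a coefficient of order [t ^+ 2], bounded in [K]. *)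
Lemma block_energy_step :
  (cos (t * (Z - H)) - c) ^+ 2 + 2 * H * ((c - b) ^+ 2 + (b - a) ^+ 2) <=
  2 * H * t ^+ 2 * (c ^+ 2 + a ^+ 2 + 2 * H * b ^+ 2
    + H / 2 * (cos (2 * t * Z') - cos (2 * t * Z))
    - (sin (2 * t * Z') - sin (2 * t * Z)) / (2 * t)
    + 4 * (H + 1) ^+ 3 * t ^+ 2).
Proof.
have t0 := t_gt0; have H1 := H_ge1; have tn : t != 0 by rewrite gt_eqF.
have e1 : (cos (t * (Z - H)) - c) ^+ 2 <= 2 * (t * H) ^+ 2 * (1 - cos (u - g)).
  have := cos_diff_sqr (t * Z) (t * H).
  have -> : t * Z - t * H = t * (Z - H) by lra.
  have -> : t * Z + t * H = t * (Z + H) by lra.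
  by have -> : 2 * (t * Z) = u - g by rewrite /u /g; lra.
have e2 : (c - b) ^+ 2 <= 2 * (t / 2) ^+ 2 * (1 - cos (u - t)).
  have := cos_diff_sqr (t * (Z + H + 1 / 2)) (t / 2).
  have -> : t * (Z + H + 1 / 2) - t / 2 = t * (Z + H) by lra.
  have -> : t * (Z + H + 1 / 2) + t / 2 = t * (Z + H + 1) by lra.
  by have -> : 2 * (t * (Z + H + 1 / 2)) = u - t by rewrite /u; lra.
have e3 : (b - a) ^+ 2 <= 2 * (t / 2) ^+ 2 * (1 - cos (u + t)).
  have := cos_diff_sqr (t * (Z + H + 3 / 2)) (t / 2).
  have -> : t * (Z + H + 3 / 2) - t / 2 = t * (Z + H + 1) by lra.
  have -> : t * (Z + H + 3 / 2) + t / 2 = t * (Z + H + 2) by lra.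
  by have -> : 2 * (t * (Z + H + 3 / 2)) = u + t by rewrite /u; lra.
have E : (sin (2 * t * Z') - sin (2 * t * Z)) / (2 * t) = cos u * (sin g / t).
  by rewrite sin_inc -mulf_div divff // mul1r mulrA.
have -> : 2 * t * Z' = u + g by rewrite /u /g /Z'; lra.
have -> : 2 * t * Z = u - g by rewrite /u /g; lra.
have -> : (sin (u + g) - sin (u - g)) / (2 * t) = cos u * (sin g / t).
  rewrite -E; congr ((sin _ - sin _) / _); rewrite /u /g /Z'; lra.
rewrite mass_inc.
have [b1 b2 b3 /andP[b4 b5]] := cos_bounds.
have K : `|cos t + cos (2 * t) + H + H * cos g - sin g / t| <= 4 * (H + 1) ^+ 3 * t ^+ 2.
  have c1 := cos_le1 t; have c2 := cos_le1 (2 * t).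
  have c3 : H * cos g <= H by rewrite ger_pMr ?cos_le1 //; lra.
  have c4 : H * (1 - 2 * (H + 1) ^+ 2 * t ^+ 2) <= H * cos g by apply: ler_wpM2l => //; lra.
  have tt := sqr_ge0 t.
  have c5 : 0 <= (2 * (H + 1) ^+ 2 + 2 * (H + 1) ^+ 3 - 5 / 2) * t ^+ 2.
    by apply: mulr_ge0 => //; nra.
  by rewrite ler_norml; apply/andP; split; lra.
have M := mul_cos_ge u K.
apply: (@le_trans _ _ (2 * H * t ^+ 2 * (H * (1 - cos (u - g))
    + (2 - cos (u - t) - cos (u + t)) / 2))).
  have := ler_wpM2l (_ : 0 <= 2 * H) (lerD e2 e3); have H0 : 0 <= 2 * H by lra.
  by move=> /(_ H0); lra.
apply: ler_wpM2l; first by rewrite mulr_ge0 ?sqr_ge0 //; lra.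
by move: M; rewrite [cos (u - g)]cosB [cos (u + g)]cosD [cos (u - t)]cosB [cos (u + t)]cosD; lra.
Qed.

Lemma block_mass_step :
  H + 1 + (sin (2 * t * Z') - sin (2 * t * Z)) / (4 * t) - 4 * (H + 1) ^+ 3 * t ^+ 2 <=
  c ^+ 2 + a ^+ 2 + 2 * H * b ^+ 2.
Proof.
have t0 := t_gt0; have H1 := H_ge1; have tn : t != 0 by rewrite gt_eqF.
have E : (sin (2 * t * Z') - sin (2 * t * Z)) / (4 * t) = cos u * (sin g / t / 2).
  rewrite sin_inc invfM; lra.
rewrite E mass_inc.
have [b1 b2 b3 /andP[b4 b5]] := cos_bounds.
have K : `|cos (2 * t) + H - sin g / t / 2| <= 4 * (H + 1) ^+ 3 * t ^+ 2.
  have c2 := cos_le1 (2 * t); have tt := sqr_ge0 t.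
  have c5 : 0 <= (2 * (H + 1) ^+ 3 - 2) * t ^+ 2.
    by apply: mulr_ge0 => //; nra.
  by rewrite ler_norml; apply/andP; split; lra.
by have M := mul_cos_ge u K; lra.
Qed.

End Step.

(* Here [s = h] without and [s = h + 1] with a pendant vertex, so that the chain ends at the
   angle [pi - 2 t s]; the terms of order 1 cancel exactly. *)
Lemma chain_end (t m H s : R) : 0 < t -> 0 <= m -> 0 <= H -> 0 <= s ->
  H + H / 2 * (cos (2 * t * s) - cos (2 * t * m)) - (sin (2 * t * s) - sin (2 * t * m)) / (2 * t)
    + (s - H) - m <= (H * m ^+ 2 + 2 * s ^+ 3) * t ^+ 2.
Proof.
move=> t0 m0 H0 s0.
have a1 : H / 2 * (cos (2 * t * s) - cos (2 * t * m)) <= H / 2 * (2 * (t * m) ^+ 2).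
  by apply: ler_wpM2l; [lra | have := cos_ge (2 * t * m); have := cos_le1 (2 * t * s); lra].
have a2 : sin (2 * t * m) <= 2 * t * m by apply: sin_le_id; rewrite !mulr_ge0 //; lra.
have a3 := @sin_ge R (2 * t * s) ltac:(rewrite !mulr_ge0 //; lra).
have a4 : s - m - 2 * s ^+ 3 * t ^+ 2 <= (sin (2 * t * s) - sin (2 * t * m)) / (2 * t).
  by rewrite ler_pdivlMr; lra.
lra.
Qed.

End ChainStep.

(** * The chain and its test function *)

Section Chain.
Variables (R : realType) (h p : nat) (t : R).
Hypothesis hp : (0 < h < p)%N.
Hypothesis t_gt0 : 0 < t.

Let m := p.*2.+1.
Let H : R := h%:R.
Let C : R := 4 * (H + 1) ^+ 3.
Let Z (q : nat) : R := m%:R + (2 * H + 2) * q%:R.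

Let H_ge1 : 1 <= H. Proof. by rewrite ler1n; case/andP: hp. Qed.

(** Both estimates are preserved by attaching a block, as the trigonometric terms telescope. The
    terms [m%:R ^+ 3 * t ^+ 2] pay for the base block, on which the test function is constant. *)
Lemma chain_exists q : exists (T : finType) (e : rel T) (r : T) (w : T -> R),
  [/\ #|T| = (m + h.*2.+2 * q)%N, rooted_graph h.*2.+1 e r, w r = cos (t * (Z q - H)),
    energy e w <= 2 * H * t ^+ 2 * (mass w - m%:R
      + H / 2 * (cos (2 * t * Z q) - cos (2 * t * m%:R))
      - (sin (2 * t * Z q) - sin (2 * t * m%:R)) / (2 * t)
      + C * t ^+ 2 * q%:R + m%:R ^+ 3 * t ^+ 2) &
    m%:R + (H + 1) * q%:R + (sin (2 * t * Z q) - sin (2 * t * m%:R)) / (4 * t)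
      - C * t ^+ 2 * q%:R - m%:R ^+ 3 * t ^+ 2 <= mass w].
Proof.
have H1 := H_ge1; have t0 := t_gt0.
elim: q => [|q [T [e [r [w [cT er wr Ew Mw]]]]]].
  exists 'I_m, (base_rel h (p := p)), ord_max, (fun=> cos (t * (Z 0 - H))).
  have -> : Z 0 = m%:R by rewrite /Z mulr0 addr0.
  have E0 : energy (base_rel h (p := p)) (fun=> cos (t * (m%:R - H))) = 0.
    rewrite /energy big1 // => x _; rewrite big1 // => y _.
    by rewrite subrr expr0n /= mulr0 mul0r.
  have M0 : mass (fun _ : 'I_m => cos (t * (m%:R - H))) = m%:R * cos (t * (m%:R - H)) ^+ 2.
    by rewrite /mass sumr_const card_ord mulr_natl.
  have Mlo : m%:R - m%:R ^+ 3 * t ^+ 2 <= m%:R * cos (t * (m%:R - H)) ^+ 2.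
    have mH : H <= m%:R by rewrite ler_nat /m; lia.
    have s1 := sin_sqr_le (t * (m%:R - H)).
    have s2 : (t * (m%:R - H)) ^+ 2 <= (t * m%:R) ^+ 2.
      by rewrite ler_sqr ?nnegrE ?mulr_ge0 //; try lra; apply: ler_wpM2l; lra.
    rewrite cos2sin2; have m0 : 0 <= m%:R :> R by [].
    by have := ler_wpM2l m0 (le_trans s1 s2); lra.
  split=> //.
  - by rewrite card_ord muln0 addn0.
  - exact: base_rooted.
  - rewrite E0 M0 !subrr !mulr0 mul0r mulr_ge0 ?mulr_ge0 ?sqr_ge0 //; lra.
  - by rewrite M0 subrr !mulr0 mul0r; lra.
have ZS : Z q.+1 = Z q + 2 * H + 2 by rewrite /Z -[q.+1%:R]natr1; lra.
have k0 : (0 < h.*2)%N by case/andP: hp; lia.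
have kE : h.*2%:R = 2 * H :> R by rewrite -mul2n natrM.
pose c := cos (t * (Z q + H)); pose b := cos (t * (Z q + H + 1)).
pose a := cos (t * (Z q + H + 2)).
exists (T + (bool + 'I_h.*2))%type, (@block_rel T e r h.*2), (block_root T h.*2).
exists (block_fun w c b a); split.
- by rewrite !card_sum card_bool card_ord cT mulnS; lia.
- exact: block_rooted.
- by rewrite ZS /= /a; congr cos; lra.
- rewrite energy_block mass_block kE ZS wr.
  have := block_energy_step (Z q) t0 H1; rewrite -/c -/b -/a -/C => S.
  rewrite -[q.+1%:R]natr1; apply: le_trans (lerD Ew S) _.
  by rewrite le_eqVlt; apply/orP; left; apply/eqP; lra.
- rewrite mass_block kE ZS -[q.+1%:R]natr1.
  have := block_mass_step (Z q) t0 H1; rewrite -/c -/b -/a -/C => S.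
  apply: le_trans (lerD Mw S).
  by rewrite le_eqVlt; apply/orP; left; apply/eqP; lra.
Qed.

Let K : R := H * m%:R ^+ 2 + 2 * (H + 1) ^+ 3 + m%:R ^+ 3.

Lemma chain_graph (q : nat) (b : bool) (n : nat) :
  n = (m + h.*2.+2 * q + b)%N -> t = pi / 2 / (n + h)%:R ->
  exists2 e : rel 'I_n, graph_family h.*2.+1 e & exists M,
    (h.*2.+1%:R - lambda1 R e) * M <= 2 * H * t ^+ 2 * (M + t ^+ 2 * (K + C * q%:R)) /\
    m%:R / 2 + (H + 1) * q%:R - t ^+ 2 * (C * q%:R + m%:R ^+ 3) <= M.
Proof.
move=> nE tE; have H1 := H_ge1; have t0 := t_gt0.
have [T [e [r [w [cT [es ec er ed] wr Ew Mw]]]]] := chain_exists q.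
pose B : R := b%:R; pose s := H + B.
have B0 : 0 <= B by [].
have B1 : B <= 1 by rewrite /B lern1 leq_b1.
(* The position [Z q + s] is the ground, where the cosine vanishes: one edge of length [2 * H]
   beyond the root, or one bridge and a layer of length 1 beyond it. *)
have tN : t * (Z q + s) = pi / 2.
  have N0 : (n + h)%:R != 0 :> R by rewrite pnatr_eq0; lia.
  have -> : Z q + s = (n + h)%:R.
    have E2 : (h.*2.+2 * q)%:R = (2 * H + 2) * q%:R :> R.
      by rewrite natrM -addn2 natrD -mul2n natrM.
    by rewrite nE (natrD _ _ h) (natrD _ _ b) (natrD _ m) E2 /Z /s /B /H; lra.
  by rewrite tE divfK.
have cZ : cos (2 * t * Z q) = - cos (2 * t * s).
  have -> : 2 * t * Z q = pi - 2 * t * s by lra.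
  by rewrite cosB cospi sinpi; lra.
have sZ : sin (2 * t * Z q) = sin (2 * t * s).
  have -> : 2 * t * Z q = pi - 2 * t * s by lra.
  by rewrite sinB cospi sinpi; lra.
have ss0 : 0 <= sin (2 * t * s).
  have Z0 : 0 <= t * Z q by rewrite mulr_ge0 ?addr_ge0 ?mulr_ge0 //; lra.
  apply: sin_ge0_pi; rewrite mulr_ge0 ?mulr_ge0 ?addr_ge0 //=; lra.
(* The value at the pendant vertex. Without one it is the value 0 at the ground, and the same term
   then measures the ground edge of the root. *)
pose pv := cos (t * (Z q + H)).
have last : (w r - pv) ^+ 2 <= 2 * H * t ^+ 2 * (H * (1 + cos (2 * t * s))).
  have := cos_diff_sqr (t * Z q) (t * H).
  have -> : t * Z q - t * H = t * (Z q - H) by lra.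
  have -> : t * Z q + t * H = t * (Z q + H) by lra.
  have -> : 2 * (t * Z q) = 2 * t * Z q by lra.
  by rewrite cZ wr -/pv; lra.
have pvE : pv = sin (t * B).
  rewrite /pv (_ : t * (Z q + H) = pi / 2 - t * B); last by rewrite /s in tN; lra.
  by rewrite cosB cos_pihalf sin_pihalf; lra.
have dleT x : (degree e x <= h.*2.+1)%N.
  by have [->|/ed->//] := eqVneq x r; rewrite er leqnSn.
have [x1 x1r] : exists x, x != r.
  have : (0 < degree e r)%N by rewrite er double_gt0; case/andP: hp.
  move=> /card_gt0P[x]; rewrite inE => erx; exists x; apply: contraTneq erx => ->.
  by case: es => _ ->.
(* One form for both parities: [M'] includes the mass of a pendant vertex, and the term with [B]
   bounds the energy of its [2 * H] ground edges. *)
suff [e' fam H'] : exists2 e' : rel 'I_n, graph_family h.*2.+1 e' & exists2 M', mass w <= M' &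
    (h.*2.+1%:R - lambda1 R e') * M' <= energy e w + (w r - pv) ^+ 2 + 2 * H * t ^+ 2 * B.
  exists e' => //; case: H' => M' MM' HM'; exists M'; split; last first.
    apply: le_trans MM'; apply: le_trans Mw.
    have : - (m%:R / 2) <= (sin (2 * t * Z q) - sin (2 * t * m%:R)) / (4 * t).
      rewrite ler_pdivlMr; last lra.
      have : sin (2 * t * m%:R) <= 2 * t * m%:R by apply: sin_le_id; rewrite !mulr_ge0 //; lra.
      by rewrite sZ; lra.
    lra.
  apply: le_trans HM' _.
  have CE := @chain_end R t m%:R H s t0 ltac:(by []) ltac:(lra) ltac:(by rewrite addr_ge0 //; lra).
  have s3 : s ^+ 3 <= (H + 1) ^+ 3 by rewrite ler_pXn2r ?nnegrE ?addr_ge0 // /s; lra.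
  have s3' := ler_wpM2r (sqr_ge0 t) s3.
  apply: le_trans (lerD (lerD Ew last) (lexx _)) _.
  rewrite -!mulrDr; apply: ler_wpM2l; first by rewrite mulr_ge0 ?sqr_ge0 //; lra.
  move: CE s3' MM'; rewrite cZ sZ /K (_ : s - H = B); last by rewrite /s; lra.
  move: (cos (2 * t * s)) (sin (2 * t * s)) (s ^+ 3) => cc sn s3v CE s3' MM'; lra.
have degr1 : degree e r <> h.*2.+1 by rewrite er; exact: n_Sn.
case: b nE @B @s B0 B1 tN cZ sZ ss0 last pvE => nE B s B0 B1 tN cZ sZ ss0 last pvE.
- have nT : #|{: T + 'I_1}| = n by rewrite card_sum card_ord cT nE addn1.
  have es' := pendant_simple r es.
  have ec' := pendant_connected r es ec.
  have [] := @graph_on_ordinals R h.*2.+1 _ (pendant_rel e r) (pendant_fun w pv) (inl r) es' ec'.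
  + case=> [u|i]; last by rewrite degree_pendant_leaf.
    rewrite degree_pendant; have [->|/ed->] := eqVneq u r; first by rewrite er addn1.
    by rewrite addn0.
  + by exists (inl r); rewrite degree_pendant er eqxx addn1.
  + exists (inr ord0); rewrite degree_pendant_leaf => -[] /esym/eqP.
    by rewrite double_eq0 eqn0Ngt; case/andP: hp => ->.
  rewrite nT mass_pendant energy_pendant big_sumType big_ord1 /= big1 => [|u _]; last first.
    rewrite degree_pendant; have [->|/ed->] := eqVneq u r; rewrite ?er.
      by rewrite addn1 subrr mul0r.
    by rewrite addn0 subrr mul0r.
  move=> e' fam He'; exists e' => //; exists (mass w + pv ^+ 2); first by rewrite lerDl sqr_ge0.
  apply: le_trans He' _; rewrite add0r lerD2l degree_pendant_leaf.
  have -> : h.*2.+1%:R - 1%:R = 2 * H :> R by rewrite -[h.*2.+1%:R]natr1 -mul2n natrM /H; lra.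
  have := sin_sqr_le t; rewrite pvE (_ : B = 1) // !mulr1 => st.
  by have := ler_wpM2l (_ : 0 <= 2 * H) st; move=> /(_ ltac:(lra)); lra.
have nT : #|T| = n by rewrite cT nE addn0.
have [] := @graph_on_ordinals R h.*2.+1 _ e w r es ec dleT.
+ by exists x1; exact: ed.
+ by exists r.
rewrite nT (bigD1 r) //= [X in _ + (_ + X)]big1 => [|x xr]; last by rewrite ed // subrr mul0r.
rewrite er addr0 => e' fam He'; exists e' => //; exists (mass w) => //.
apply: le_trans He' _.
have -> : h.*2.+1%:R - h.*2%:R = 1 :> R by rewrite -[h.*2.+1%:R]natr1; lra.
by rewrite pvE (_ : B = 0) // !mulr0 sin0; lra.
Qed.

End Chain.

(** * Asymptotics *)

Lemma graph_rel_ffun (n : nat) (e : rel 'I_n) :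
  (fun i j => [ffun x : 'I_n * 'I_n => e x.1 x.2] (i, j)) = e.
Proof. by apply/funext => i; apply/funext => j; rewrite ffunE. Qed.

(** Encoding relations as finite functions makes the family finite, so the maximum is attained. *)
Lemma rho_max (R : realType) (n d : nat) (e0 : rel 'I_n) : graph_family d e0 ->
  (exists2 e : rel 'I_n, graph_family d e & rho R n d = lambda1 R e) /\
  (forall e : rel 'I_n, graph_family d e -> lambda1 R e <= rho R n d).
Proof.
move=> fam0.
pose rl (f : {ffun 'I_n * 'I_n -> bool}) : rel 'I_n := fun i j => f (i, j).
pose P f := `[< graph_family d (rl f) >].
pose ff (e : rel 'I_n) : {ffun 'I_n * 'I_n -> bool} := [ffun x => e x.1 x.2].
have rlK e : rl (ff e) = e by exact: graph_rel_ffun.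
have P0 : P (ff e0) by apply/asboolP; rewrite rlK.
case: (Order.TotalTheory.arg_maxP (fun f => lambda1 R (rl f)) P0) => f /asboolP Pf fmax.
have fub (e : rel 'I_n) : graph_family d e -> lambda1 R e <= lambda1 R (rl f).
  move=> fam; have := fmax (ff e); rewrite rlK; apply.
  by apply/asboolP; rewrite rlK.
have rE : rho R n d = lambda1 R (rl f).
  apply: xget_subset1.
    split; first by exists (rl f).
    by move=> _ [e fam <-]; exact: fub.
  move=> a b [aA au] [bA bu]; apply/eqP; rewrite eq_le.
  by apply/andP; split; [exact: (bu _ aA) | exact: (au _ bA)].
split; first by exists (rl f).
by move=> e fam; rewrite rE fub.
Qed.

(** Beyond the smallest base of order [2 h + 3], the parity of the excess decides on the pendant
    vertex; half of the rest is divided by [h + 1], the quotient counting blocks and the remainder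
    enlarging the base. *)
Lemma chain_parameters (h n : nat) : (h.*2 + 3 <= n)%N -> exists p q (b : bool),
  [/\ (h < p)%N, (p <= h.*2.+1)%N & n = (p.*2.+1 + h.*2.+2 * q + b)%N].
Proof.
move=> hn; pose x := (n - (h.*2 + 3))./2.
exists (h.+1 + x %% h.+1)%N, (x %/ h.+1)%N, (odd (n - (h.*2 + 3))).
have xE := odd_double_half (n - (h.*2 + 3)); rewrite -/x in xE.
have dE := divn_eq x h.+1; have ml := @ltn_pmod x h.+1 isT.
split; first by lia.
  by lia.
have -> : (h.*2.+2 * (x %/ h.+1) = (x %/ h.+1 * h.+1).*2)%N by rewrite -mul2n; lia.
by move: (odd _) xE (x %/ h.+1 * h.+1)%N dE => b xE z dE; lia.
Qed.

(** * Both bounds for large order *)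

Section LargeOrder.
Variables (R : realType) (h : nat).
Hypothesis h_gt0 : (0 < h)%N.
Let d := h.*2.+1.
Let H : R := h%:R.
Let angle (n : nat) : R := pi / 2 / (n + h)%:R.

Let dE : d%:R = 2 * H + 1 :> R.
Proof. by rewrite /d -[h.*2.+1%:R]natr1 -mul2n natrM. Qed.

Let angle_bounds n : (0 < n)%N -> 0 < angle n /\ angle n * n%:R <= 2.
Proof.
move=> n0; have nh : 0 < (n + h)%:R :> R by rewrite ltr0n; lia.
split; first by rewrite !divr_gt0 ?pi_gt0.
rewrite /angle mulrAC ler_pdivrMr //.
have p2 := pihalf_lt2 R; have p0 := pi_gt0 R.
by apply: ler_pM => //; [lra | lra | rewrite ler_nat leq_addr].
Qed.

(** The test function has mass [M] at least [n / 4], while the error [K' + C * q] is at most of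
    order [n]; dividing by [M] leaves an error of order [t ^+ 4]. *)
Lemma lambda1_lower : exists (K : R) (n0 : nat), forall n, (n0 <= n)%N ->
  exists2 e : rel 'I_n, graph_family d e &
    d%:R - (d%:R - 1) * angle n ^+ 2 - K * angle n ^+ 4 <= lambda1 R e.
Proof.
have H1 : 1 <= H by rewrite ler1n.
(* [mB] bounds the order of the base block, which is at most [4 h + 3]. *)
pose C : R := 4 * (H + 1) ^+ 3; pose mB : R := 4 * H + 3.
pose KB := H * mB ^+ 2 + 2 * (H + 1) ^+ 3 + mB ^+ 3.
have C0 : 0 <= C by rewrite mulr_ge0 // exprn_ge0; lra.
have mB0 : 0 <= mB by rewrite /mB; lra.
have mB3 : 0 <= mB ^+ 3 by rewrite exprn_ge0.
have KB0 : 0 <= KB.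
  by rewrite /KB !addr_ge0 ?mulr_ge0 ?sqr_ge0 ?exprn_ge0 //; lra.
(* Chosen so that, with [t * n <= 2], the mass lost to errors is at most [1 / 4]. *)
pose n1 := Num.trunc (16 * (C + mB ^+ 3)).
exists (8 * H * (KB + C)), (n1 + h.*2 + 4)%N => n nn0.
have [n_gt0 n_ge3 n1n hn] : [/\ (0 < n)%N, (3 <= n)%N, (n1 < n)%N & (h.*2 + 3 <= n)%N].
  by clearbody n1; split; clear -nn0; lia.
have [p [q [b [hp ph nE]]]] := chain_parameters hn.
have pN : (p.*2.+1 <= 4 * h + 3)%N by clear -ph; lia.
have qN : (q <= n)%N by clear -nE; nia.
have [t0 tn] := angle_bounds n_gt0; set t := angle n in t0 tn *.
have [e fam [M [HM MM]]] := chain_graph (introT andP (conj h_gt0 hp)) t0 nE erefl.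
exists e => //.
have nR : 16 * (C + mB ^+ 3) <= n%:R.
  apply: (@le_trans _ _ n1.+1%:R); last by rewrite ler_nat.
  by apply/ltW/truncnS_gt; apply: num_real.
have n3 : 3 <= n%:R :> R by rewrite (ler_nat _ 3).
have mle : p.*2.+1%:R <= mB :> R.
  by rewrite /mB /H -[4 * _]natrM -natrD ler_nat.
have m0 : 0 <= p.*2.+1%:R :> R by [].
have qn : q%:R <= n%:R :> R by rewrite ler_nat.
have nhalf : (n%:R - 1) / 2 <= p.*2.+1%:R / 2 + (H + 1) * q%:R.
  have E2 : (h.*2.+2 * q)%:R = (2 * H + 2) * q%:R :> R.
    by rewrite natrM -addn2 natrD -mul2n natrM.
  have b1 : b%:R <= 1 :> R by rewrite lern1 leq_b1.
  by rewrite {1}nE (natrD _ _ b) (natrD _ p.*2.+1) E2; lra.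
move: HM MM nhalf; rewrite -/d -/H -/C.
set m : R := p.*2.+1%:R in mle m0 *.
have m3 : m ^+ 3 <= mB ^+ 3 by rewrite ler_pXn2r ?nnegrE.
have m2 : m ^+ 2 <= mB ^+ 2 by rewrite ler_sqr ?nnegrE.
have Km : H * m ^+ 2 + 2 * (H + 1) ^+ 3 + m ^+ 3 <= KB.
  have := ler_wpM2l (_ : 0 <= H) m2; move=> /(_ ltac:(lra)).
  by rewrite /KB; lra.
move: (H * m ^+ 2 + 2 * (H + 1) ^+ 3 + m ^+ 3) Km => K' Km.
move: (m ^+ 3) m3 (p.*2.+1%:R / 2 + (H + 1) * q%:R) => m3v m3 L HM MM nhalf.
have q0 : 0 <= q%:R :> R by [].
have tt : (t * n%:R) ^+ 2 <= 4.
  have -> : (4 : R) = 2 ^+ 2 by lra.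
  by rewrite ler_sqr ?nnegrE // mulr_ge0 // ltW.
have A1 : C * q%:R + m3v <= (C + mB ^+ 3) * n%:R.
  have := ler_wpM2l C0 qn; have : mB ^+ 3 * 1 <= mB ^+ 3 * n%:R by apply: ler_wpM2l => //; lra.
  lra.
have A2 : t ^+ 2 * (C * q%:R + m3v) <= 1 / 4.
  have A3 := ler_wpM2l (sqr_ge0 t) A1.
  have A4 : t ^+ 2 * n%:R * (16 * (C + mB ^+ 3)) <= t ^+ 2 * n%:R * n%:R.
    by apply: ler_wpM2l nR; rewrite mulr_ge0 ?sqr_ge0.
  lra.
have Mn : n%:R / 4 <= M by lra.
have M0 : 0 < M by lra.
have A5 : K' + C * q%:R <= 4 * (KB + C) * M.
  have B1 := ler_wpM2l C0 qn.
  have B2 : KB * 1 <= KB * n%:R by apply: ler_wpM2l => //; lra.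
  have B3 : (KB + C) * n%:R <= (KB + C) * (4 * M) by apply: ler_wpM2l; [rewrite addr_ge0 | lra].
  lra.
suff F : (d%:R - lambda1 R e) * M <= ((d%:R - 1) * t ^+ 2 + 8 * H * (KB + C) * t ^+ 4) * M.
  by rewrite ler_pM2r // in F; lra.
have T0 : 0 <= 2 * H * t ^+ 2 * t ^+ 2.
  by apply: mulr_ge0 (sqr_ge0 t); apply: mulr_ge0 (sqr_ge0 t); lra.
have A6 := ler_wpM2l T0 A5.
rewrite dE; rewrite dE in HM; lra.
Qed.

Lemma rho_expansion : exists (K : R) (n0 : nat), forall n, (n0 <= n)%N ->
  `|rho R n d - (d%:R - (d%:R - 1) * angle n ^+ 2)| <= K * n%:R ^- 4.
Proof.
have [K [n0 low]] := lambda1_lower.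
pose K' : R := (d%:R - 1) * (1 + 6 * (d%:R + 1) ^+ 4 * d%:R).
exists (16 * (`|K| + `|K'|)), n0.+1 => n nn0.
have n_gt0 : (0 < n)%N by lia.
have [t0 tn] := angle_bounds n_gt0.
have [e fam le] := low n (ltnW nn0).
have [[e' fam' rE] rub] := @rho_max R n d e fam.
have up := lambda1_upper R h_gt0 fam'; rewrite /= -/(angle n) -/d -/K' in up.
have r1 := rub e fam; rewrite -rE in up.
have nR : 0 < n%:R :> R by rewrite ltr0n.
have t4 : angle n ^+ 4 <= 16 * n%:R ^- 4.
  rewrite ler_pdivlMr ?exprn_gt0 // -exprMn.
  have -> : (16 : R) = 2 ^+ 4 by lra.
  by apply: lerXn2r tn; rewrite nnegrE // mulr_ge0 ?ler0n // ltW.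
have t40 : 0 <= angle n ^+ 4 by rewrite exprn_ge0 // ltW.
have B1 : K * angle n ^+ 4 <= `|K| * (16 * n%:R ^- 4).
  by apply: le_trans (ler_wpM2r t40 (ler_norm K)) (ler_wpM2l (normr_ge0 K) t4).
have B2 : K' * angle n ^+ 4 <= `|K'| * (16 * n%:R ^- 4).
  by apply: le_trans (ler_wpM2r t40 (ler_norm K')) (ler_wpM2l (normr_ge0 K') t4).
have n4 : 0 <= n%:R ^- 4 :> R by rewrite invr_ge0 exprn_ge0.
have B3 := mulr_ge0 (normr_ge0 K) n4; have B4 := mulr_ge0 (normr_ge0 K') n4.
rewrite ler_norml; apply/andP; split; lra.
Qed.

End LargeOrder.

(** * From explicit errors to Landau notation *)

Lemma eq_addO_inv4 (R : realType) (f g : nat -> R) :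
  (exists (K : R) (n0 : nat), forall n, (n0 <= n)%N -> `|f n - g n| <= K * n%:R ^- 4) ->
  f = g +O_\oo (fun n : nat => n%:R ^- 4 : R).
Proof.
move=> [K [n0 H]]; apply/eqaddOP/bigO_exP.
exists (`|K| + 1); first by rewrite ltr_wpDl.
near=> n.
have n4 : 0 <= n%:R ^- 4 :> R by rewrite invr_ge0 exprn_ge0.
rewrite (ger0_norm n4); apply: le_trans (H n _) _.
  by near: n; exact: nbhs_infty_ge.
by apply: ler_wpM2r => //; have := ler_norm K; lra.
Unshelve. all: by end_near. Qed.

(** With [a = 1 / x] and [b = 1 / (x + H)], the relation [a = b * (1 + H * a)] makes the error
    exactly [(3 * H ^+ 2 + 2 * H ^+ 3 * a) * a ^+ 2 * b ^+ 2], and [b <= a <= 1]. *)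
Lemma inv_sqr_expansion (R : realType) (H x : R) : 0 <= H -> 1 <= x ->
  `|(x + H) ^- 2 - x ^- 2 + 2 * H * x ^- 3| <= (3 * H ^+ 2 + 2 * H ^+ 3) * x ^- 4.
Proof.
move=> H0 x1; have xn : x != 0 by rewrite gt_eqF //; lra.
have xHn : x + H != 0 by rewrite gt_eqF //; lra.
have a0 : 0 < x^-1 by rewrite invr_gt0; lra.
have b0 : 0 < (x + H)^-1 by rewrite invr_gt0; lra.
have a1 : x^-1 <= 1 by rewrite invf_le1 //; lra.
have ba : (x + H)^-1 <= x^-1 by rewrite lef_pV2 ?posrE; lra.
have ab : x^-1 = (x + H)^-1 * (1 + H * x^-1).
  have -> : 1 + H * x^-1 = (x + H) * x^-1 by rewrite mulrDl divff.
  by rewrite mulKf.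
rewrite -!exprVn.
move: (x^-1) ((x + H)^-1) a0 b0 a1 ba ab => a b a0 b0 a1 ba ab.
have a2 : a ^+ 2 = b ^+ 2 * (1 + H * a) ^+ 2 by rewrite -exprMn -ab.
have /= a3 := congr1 (fun z => 2 * H * a * z) a2.
have -> : b ^+ 2 - a ^+ 2 + 2 * H * a ^+ 3 = (3 * H ^+ 2 + 2 * H ^+ 3 * a) * a ^+ 2 * b ^+ 2 by lra.
have h3 : 0 <= H ^+ 3 by rewrite exprn_ge0.
have h2 : 0 <= H ^+ 2 by rewrite exprn_ge0.
have c0 : 0 <= 3 * H ^+ 2 + 2 * H ^+ 3 * a.
  by have := mulr_ge0 h3 (ltW a0); lra.
rewrite ger0_norm; last exact: mulr_ge0 (mulr_ge0 c0 (sqr_ge0 a)) (sqr_ge0 b).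
have -> : a ^+ 4 = a ^+ 2 * a ^+ 2 by lra.
rewrite [leRHS]mulrA; apply: ler_pM.
- exact: mulr_ge0 c0 (sqr_ge0 a).
- exact: sqr_ge0.
- apply: ler_wpM2r; first exact: sqr_ge0.
  by have := ler_wpM2l h3 a1; lra.
by apply: lerXn2r ba; rewrite nnegrE ltW.
Qed.

Theorem theorem1p7 (R : realType) (d : nat) (d_ge3 : (3 <= d)%N) (d_odd : odd d) :
  (fun n : nat => rho R n d) =
    (fun n : nat =>
       d%:R - (d%:R - 1) * pi ^+ 2 / (4 * (n%:R + (d%:R - 1) / 2) ^+ 2))
    +O_\oo (fun n : nat => n%:R ^- 4 : R)
  /\
  (fun n : nat => rho R n d) =
    (fun n : nat =>
       d%:R - (d%:R - 1) * pi ^+ 2 / (4 * n%:R ^+ 2)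
       + (d%:R - 1) ^+ 2 * pi ^+ 2 / (4 * n%:R ^+ 3))
    +O_\oo (fun n : nat => n%:R ^- 4 : R).
Proof.
pose h := d./2.
have dh : d = h.*2.+1 by rewrite -[LHS]odd_double_half d_odd.
have h_gt0 : (0 < h)%N by move: d_ge3; rewrite dh; case: (h).
have dE : d%:R = 2 * h%:R + 1 :> R by rewrite dh -[h.*2.+1%:R]natr1 -mul2n natrM.
have [K [n0 HK]] := rho_expansion R h_gt0.
(* Since [(d - 1) / 2 = h], the first formula is exactly the one in the angle [pi / 2 / (n + h)]. *)
have main n : d%:R - (d%:R - 1) * pi ^+ 2 / (4 * (n%:R + (d%:R - 1) / 2) ^+ 2) =
    d%:R - (d%:R - 1) * (pi / 2 / (n + h)%:R) ^+ 2 :> R.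
  have -> : n%:R + (d%:R - 1) / 2 = (n + h)%:R :> R by rewrite natrD dE; lra.
  by rewrite invfM !exprMn exprVn; lra.
split; apply: eq_addO_inv4.
  by exists K, n0 => n nn0; rewrite main dh; exact: HK.
pose c : R := (d%:R - 1) * pi ^+ 2 / 4.
have c0 : 0 <= c.
  rewrite /c dE addrK; apply: mulr_ge0 => //; apply: mulr_ge0 (sqr_ge0 _).
  exact: mulr_ge0.
pose L : R := 3 * h%:R ^+ 2 + 2 * h%:R ^+ 3.
exists (K + c * L), (maxn n0 1) => n; rewrite geq_max => /andP[nn0 n1].
have H1 := HK n nn0; rewrite -dh -main in H1.
(* Scaled by [c], the term [2 * h * n ^- 3] becomes the cubic term of the second formula. *)
have H2 := @inv_sqr_expansion R h%:R n%:R (ler0n _ _) ltac:(by rewrite ler1n).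
have H3 := ler_wpM2l c0 H2; rewrite -[X in X * _ <= _](ger0_norm c0) -normrM in H3.
set g1 := d%:R - _ in H1.
set X := (n%:R + h%:R) ^- 2 - _ + _ in H3.
have -> : rho R n d - (d%:R - (d%:R - 1) * pi ^+ 2 / (4 * n%:R ^+ 2)
    + (d%:R - 1) ^+ 2 * pi ^+ 2 / (4 * n%:R ^+ 3)) = (rho R n d - g1) - c * X.
  have -> : g1 = d%:R - (d%:R - 1) * pi ^+ 2 / (4 * (n%:R + h%:R) ^+ 2).
    by rewrite /g1 (_ : (d%:R - 1) / 2 = h%:R) // dE; lra.
  by rewrite /c /X !invfM dE; lra.
apply: le_trans (ler_normB _ _) _; rewrite mulrDl; apply: lerD => //.
by rewrite -mulrA.
Qed.
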